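(* Under the assumptions (H1)--(H4) listed in the context, fix any feasible solution $(\bar x(\cdot),\bar a(\cdot),\bar b(\cdot),\bar u(\cdot))$ to the problem $(P)$ described there such that $\dot{\bar x}(\cdot),\dot{\bar a}(\cdot),\dot{\bar b}(\cdot)$ and $\bar u(\cdot)$ are of bounded variation on $[0,T]$, i.e. $$\max\{\mathrm{var}(\dot{\bar x};[0,T]),\mathrm{var}(\dot{\bar a};[0,T]),\mathrm{var}(\dot{\bar b};[0,T]),\mathrm{var}(\bar u;[0,T])\}\le K$$ for some constant $K>0$. Then there exist partitions $\Delta_k$, $k=1,2,\ldots$, $$\Delta_k=\{0=t_0^k<t_1^k<\ldots<t^k_{\nu(k)}=T\},\qquad h_j^k:=t_{j+1}^k-t_j^k\le\frac{\tilde\nu}{\nu(k)},\quad j=0,\ldots,\nu(k)-1,$$ with $\nu(k)\ge k$ and some constant $\tilde\nu>0$, together with sequences of piecewise linear functions $(x^k(t),a^k(t),b^k(t))$ and piecewise constant functions $u^k(t)$ on $[0,T]$, and a sequence of positive numbers $\delta_k$ converging to zero, such that $(x^k(0),a^k(0),b^k(0))=(x_0,a_0,b_0)$ for all $k\in\mathbb{N}$, $$1-\delta_k\le\|a_i^k(t_j^k)\|\le1+\delta_k\quad\text{for all } t_j^k\in\Delta_k,\ i=1,\ldots,m,$$ $$x^k(t)=x^k(t_j^k)+(t-t_j^k)v_j^k,\quad t_j^k\le t\le t_{j+1}^k,\quad\text{with } -v_j^k\in F\big(x^k(t_j^k),a^k(t_j^k),b^k(t_j^k),u^k(t_j^k)\big),\quad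 j=0,\ldots,\nu(k)-1,$$ and, as $k\to\infty$, $(x^k(\cdot),a^k(\cdot),b^k(\cdot))\to(\bar x(\cdot),\bar a(\cdot),\bar b(\cdot))$ in the $W^{1,2}$-norm topology on $[0,T]$ and $u^k(\cdot)\to\bar u(\cdot)$ in the $L^2$-norm topology on $[0,T]$.
   Context: Normal cone: for convex $C\subset\mathbb{R}^n$, $N(x;C):=\{v\mid\langle v,y-x\rangle\le0\ \forall y\in C\}$ if $x\in C$, and $N(x;C):=\emptyset$ if $x\notin C$. For $a=(a_1,\ldots,a_m)\in\mathbb{R}^{mn}$, $b\in\mathbb{R}^m$ put $C(a,b):=\{x\in\mathbb{R}^n\mid\langle a_i,x\rangle\le b_i,\ i=1,\ldots,m\}$ and $$F(x,a,b,u):=N(x;C(a,b))-g(x,u).$$ Problem $(P)$. Given $T>0$, $x_0\in\mathbb{R}^n$, $U\subset\mathbb{R}^d$, $g:\mathbb{R}^n\times\mathbb{R}^d\to\mathbb{R}^n$, $\varphi:\mathbb{R}^n\to(-\infty,\infty]$ and $\ell:[0,T]\times\mathbb{R}^{2(n+nm+m)+d}\to(-\infty,\infty]$, minimize $\varphi(x(T))+\int_0^T\ell(t,x,a,b,u,\dot x,\dot a,\dot b)\,dt$ over $x(\cdot)\in W^{1,2}([0,T];\mathbb{R}^n)$, $a(\cdot)=(a_1,\ldots,a_m)\in W^{1,2}([0,T];\mathbb{R}^{mn})$, $b(\cdot)\in W^{1,2}([0,T];\mathbb{R}^m)$, $u(\cdot)\in L^2([0,T];\mathbb{R}^d)$ subject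 to $$\dot x(t)\in-N(x(t);C(t))+g(x(t),u(t))\ \text{a.e. } t\in[0,T],\quad x(0)=x_0\in C(0),\quad u(t)\in U\ \text{a.e.},$$ $C(t):=C(a(t),b(t))$, and $\|a_i(t)\|=1$ for all $t\in[0,T]$, $i=1,\ldots,m$ (and implicitly $\langle a_i(t),x(t)\rangle\le b_i(t)$ for all $t$). Such quadruples with integrable running cost are the feasible solutions of $(P)$. The initial points $a(0)=a_0$, $b(0)=b_0$ are fixed. Assumptions. (H1) $U$ is closed and bounded. (H2) The derivatives $(\dot a_i(t),\dot b_i(t))$ are uniformly bounded for all $i$ and a.e. $t\in[0,T]$, with fixed initial points $a_0,b_0$. (H3) There is $L>0$ with $\|g(x_1,u_1)-g(x_2,u_2)\|\le L(\|x_1-x_2\|+\|u_1-u_2\|)$ for all $(x_1,u_1),(x_2,u_2)\in\mathbb{R}^n\times U$, and there is $M>0$ with $\|g(x,u)\|\le M(1+\|x\|)$ for all $x\in\mathbb{R}^n$, $u\in U$. (H4) There are $v_i(\cdot)\in W^{1,2}([0,T];\mathbb{R})$, $i=1,\ldots,m$, with $\|a_i(t)-a_i(s)\|\le|v_i(t)-v_i(s)|$ for all $s,t\in[0,T]$; and there is a continuous $\vartheta:[0,T]\to\mathbb{R}$ with $\sup_{[0,T]}\vartheta<0$ such that $\{x\mid\langle a_i(t),x\rangle-b_i(t)<\vartheta(t),\ i=1,\ldots,m\}\ne\emptyset$ for all $t\in[0,T]$. Here $\mathrm{var}(f;[0,T])$ denotes the total variation of $f$ on $[0,T]$; the bounded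 variation assumption means that $\dot{\bar x},\dot{\bar a},\dot{\bar b},\bar u$ can be taken to be defined everywhere on $[0,T]$. *)

(* Defs.v *)
From HB Require Import structures.
From mathcomp Require Import all_boot all_order all_algebra.
From mathcomp Require Import all_classical all_reals all_analysis.

Set Implicit Arguments.
Unset Strict Implicit.
Unset Printing Implicit Defensive.

Import Order.TTheory GRing.Theory Num.Theory.
Import numFieldNormedType.Exports.

Local Open Scope classical_set_scope.
Local Open Scope ring_scope.

(* R^n is 'rV[R]_n and R^(mn) is 'M[R]_(m, n), the vector a_i being row i.
   The norm `|_| of the library on these types is the sup norm, so the
   Euclidean (for matrices: Frobenius) structure is introduced separately. *)

Section euclidean.
Context {R : realType}.

Definition dotp p q (A B : 'M[R]_(p, q)) : R := \sum_i \sum_j A i j * B i j.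

Definition enorm p q (A : 'M[R]_(p, q)) : R := Num.sqrt (dotp A A).

(* The Euclidean counterparts of [variation] and [total_variation]. *)
Definition evariation p q (f : R -> 'M[R]_(p, q)) (a b : R) (s : seq R) : R :=
  let F := f \o nth b (a :: s) in
  \sum_(0 <= i < size s) enorm (F i.+1 - F i).

Definition etotal_variation p q (f : R -> 'M[R]_(p, q)) (a b : R) : \bar R :=
  ereal_sup
    (EFin @` [set evariation f a b s | s in [set s | itv_partition a b s]]).

End euclidean.

(* L^2 and W^{1,2} on [0, T].  A curve is a total function on R of which only
   the values on [0, T] matter. *)
Section function_spaces.
Context {R : realType}.
Implicit Types T : R.

Definition L2_scalar T (f : R -> R) : Prop :=
  f \_ `[0, T] \in Lfun (@lebesgue_measure R) 2%:E.

Definition L2 T p q (f : R -> 'M[R]_(p, q)) : Prop :=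
  forall i j, L2_scalar T (fun t => f t i j).

Definition L2norm T p q (f : R -> 'M[R]_(p, q)) : \bar R :=
  Lnorm (@lebesgue_measure R) 2%:E (EFin \o ((fun t => enorm (f t)) \_ `[0, T])).

(* [W12_scalar T f df]: f is an absolutely continuous function on [0, T], with
   derivative (class) in L^2 represented by df. *)
Definition W12_scalar T (f df : R -> R) : Prop :=
  L2_scalar T df /\
  forall t, t \in `[0, T] ->
    f t = f 0 + \int[@lebesgue_measure R]_(s in `[0, t]) df s.

Definition W12 T p q (f df : R -> 'M[R]_(p, q)) : Prop :=
  forall i j, W12_scalar T (fun t => f t i j) (fun t => df t i j).

Definition W12norm T p q (f df : R -> 'M[R]_(p, q)) : \bar R :=
  ((L2norm T f `^ 2 + L2norm T df `^ 2) `^ 2^-1)%E.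

Definition L2_cvg T p q (f_ : nat -> R -> 'M[R]_(p, q))
    (f : R -> 'M[R]_(p, q)) : Prop :=
  [/\ forall k, L2 T (f_ k), L2 T f &
      L2norm T (fun t => f_ k t - f t) @[k --> \oo] --> 0%E].

(* W12norm does not depend on the representatives df_ k and df. *)
Definition W12_cvg T p q (f_ : nat -> R -> 'M[R]_(p, q))
    (f : R -> 'M[R]_(p, q)) : Prop :=
  exists df_ df,
    [/\ forall k, W12 T (f_ k) (df_ k), W12 T f df &
        W12norm T (fun t => f_ k t - f t) (fun t => df_ k t - df t)
          @[k --> \oo] --> 0%E].

(* Integrability for the completed measure: the library's [integrable] asks for
   Borel measurability, hence the passage to an almost everywhere equal
   function. *)
Definition lebesgue_integrable T (f : R -> \bar R) : Prop :=
  exists2 c : R -> \bar R,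
    (@lebesgue_measure R).-integrable `[0, T] c &
    {ae @lebesgue_measure R, forall t, t \in `[0, T] -> f t = c t}.

End function_spaces.

Section partitions.
Context {R : realType}.
Implicit Types (T : R) (N : nat) (t : nat -> R).

Definition mesh_points T N t : Prop :=
  [/\ t 0 = 0, t N = T & forall j, (j < N)%N -> t j < t j.+1].

Definition piecewise_linear N t p q (f : R -> 'M[R]_(p, q)) : Prop :=
  forall j s, (j < N)%N -> t j <= s <= t j.+1 ->
    f s = f (t j) + ((s - t j) / (t j.+1 - t j)) *: (f (t j.+1) - f (t j)).

Definition piecewise_constant N t p q (f : R -> 'M[R]_(p, q)) : Prop :=
  forall j s, (j < N)%N -> t j <= s < t j.+1 -> f s = f (t j).

End partitions.

Section sweeping.
Context {R : realType}.

Definition normal_cone n (x : 'rV[R]_n) (C : set 'rV[R]_n) : set 'rV[R]_n :=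
  [set v | C x /\ forall y, C y -> dotp v (y - x) <= 0].

Definition polyhedron m n (a : 'M[R]_(m, n)) (b : 'rV[R]_m) : set 'rV[R]_n :=
  [set x | forall i, dotp (row i a) x <= b 0 i].

Definition sweep_map n m d (g : 'rV[R]_n -> 'rV[R]_d -> 'rV[R]_n)
    (x : 'rV[R]_n) (a : 'M[R]_(m, n)) (b : 'rV[R]_m) (u : 'rV[R]_d) :
    set 'rV[R]_n :=
  [set v - g x u | v in normal_cone x (polyhedron a b)].

Record problem (n m d : nat) := Problem {
  horizon : R;
  horizon_gt0 : 0 < horizon;
  start_x : 'rV[R]_n;
  start_a : 'M[R]_(m, n);
  start_b : 'rV[R]_m;
  controls : set 'rV[R]_d;
  perturbation : 'rV[R]_n -> 'rV[R]_d -> 'rV[R]_n;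
  terminal_cost : 'rV[R]_n -> \bar R;
  terminal_cost_gtNy : forall y, (-oo < terminal_cost y)%E;
  running_cost : R -> 'rV[R]_n -> 'M[R]_(m, n) -> 'rV[R]_m -> 'rV[R]_d ->
    'rV[R]_n -> 'M[R]_(m, n) -> 'rV[R]_m -> \bar R;
  running_cost_gtNy : forall t x a b u dx da db, t \in `[0, horizon] ->
    (-oo < running_cost t x a b u dx da db)%E }.

Definition cost n m d (P : problem n m d)
    (x : R -> 'rV[R]_n) (a : R -> 'M[R]_(m, n)) (b : R -> 'rV[R]_m)
    (u : R -> 'rV[R]_d)
    (dx : R -> 'rV[R]_n) (da : R -> 'M[R]_(m, n)) (db : R -> 'rV[R]_m) :
    \bar R :=
  (terminal_cost P (x (horizon P)) +
   \int[@lebesgue_measure R]_(t in [set` `[0%R, horizon P]%R])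
     running_cost P t (x t) (a t) (b t) (u t) (dx t) (da t) (db t))%E.

(* dx, da, db represent the derivatives of x, a, b. *)
Record feasible n m d (P : problem n m d)
    (x : R -> 'rV[R]_n) (a : R -> 'M[R]_(m, n)) (b : R -> 'rV[R]_m)
    (u : R -> 'rV[R]_d)
    (dx : R -> 'rV[R]_n) (da : R -> 'M[R]_(m, n)) (db : R -> 'rV[R]_m) :
    Prop := Feasible {
  feasible_W12x : W12 (horizon P) x dx;
  feasible_W12a : W12 (horizon P) a da;
  feasible_W12b : W12 (horizon P) b db;
  feasible_L2u : L2 (horizon P) u;
  feasible_incl : {ae @lebesgue_measure R, forall t, t \in `[0, horizon P] ->
    [set - v + perturbation P (x t) (u t) |
       v in normal_cone (x t) (polyhedron (a t) (b t))] (dx t)};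
  feasible_x0 : x 0 = start_x P;
  feasible_a0 : a 0 = start_a P;
  feasible_b0 : b 0 = start_b P;
  feasible_C0 : polyhedron (a 0) (b 0) (start_x P);
  feasible_u : {ae @lebesgue_measure R, forall t, t \in `[0, horizon P] ->
    controls P (u t)};
  feasible_a1 : forall t i, t \in `[0, horizon P] -> enorm (row i (a t)) = 1;
  feasible_state : forall t i, t \in `[0, horizon P] ->
    dotp (row i (a t)) (x t) <= b t 0 i;
  feasible_cost : lebesgue_integrable (horizon P) (fun t =>
    running_cost P t (x t) (a t) (b t) (u t) (dx t) (da t) (db t)) }.

End sweeping.

Arguments problem R n m d : clear implicits.

(* Main.v *)
Require Import Defs.
From HB Require Import structures.
From mathcomp Require Import all_boot all_order all_algebra.
From mathcomp Require Import all_classical all_reals all_analysis.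
From mathcomp Require Import measurable_realfun ring lra.

Set Implicit Arguments.
Unset Strict Implicit.
Unset Printing Implicit Defensive.

Import Order.TTheory GRing.Theory Num.Theory.
Import numFieldNormedType.Exports.

Local Open Scope classical_set_scope.
Local Open Scope ring_scope.

(** Sweep the given trajectory along with a moving copy of the polyhedron.  At a
    mesh node t_j let the discrete state X_j deviate from x(t_j) by e_j, keep the
    normals a_i(t_j), and replace each b_i(t_j) by b_i(t_j) + <a_i(t_j), e_j>.
    The discrete polyhedron is the original one translated by e_j, so its normal
    cone at X_j is the cone of the original one at x(t_j)
    ([normal_cone_translate]).  If the differential inclusion holds at t_j, with
    x'(t_j) = - w + g(x(t_j), u(t_j)), then - w + g(X_j, u(t_j)) is an admissible
    discrete velocity at X_j.  The Euler scheme with these velocities defines the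
    X_j exactly, with no projection and no closeness assumption; the sampled
    normals even keep norm 1.

    The inclusion holds almost everywhere, so the inner nodes can be chosen among
    its points of validity in an almost uniform mesh ([mesh_in_ae]).  At the
    initial node, where nothing may be assumed, the zero normal vector is used.

    Why this converges: on the j-th mesh interval, x', a', b' and u oscillate by
    at most W(t_{j+1}) - W(t_j) for a common nondecreasing function W
    ([bv_modulus]).  The scheme therefore has a velocity defect which is summable
    over the mesh, plus a Lipschitz multiple of |e_j|, and Gronwall's lemma
    ([discrete_gronwall], [deviation_le]) gives |e_j| <= G h with h the mesh size.
    The slope of the correction <a_i, e> is by the product rule again controlled
    by the velocity defect and by h.  Altogether the derivatives of the discrete
    curves, and the discrete controls, differ from the given ones by at most c_j
    on the j-th interval, where the sum of the c_j is bounded by some Q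
    independent of the mesh ([tracking_scheme]).  Then the square of the L^2 norm
    of the difference is at most the sum of h c_j^2, hence at most Q^2 h
    ([mesh_sqr_integral_le]), and the curves themselves, which agree at 0, differ
    by O(h) ([polygon_error]). *)

(** * The Euclidean norm of matrices *)

Section euclidean_norm.
Context {R : realType}.

Lemma dotpC p q (A B : 'M[R]_(p, q)) : dotp A B = dotp B A.
Proof. by apply: eq_bigr => i _; apply: eq_bigr => j _; rewrite mulrC. Qed.

Lemma dotpDl p q (A B C : 'M[R]_(p, q)) : dotp (A + B) C = dotp A C + dotp B C.
Proof.
rewrite /dotp -big_split; apply: eq_bigr => i _ /=.
by rewrite -big_split; apply: eq_bigr => j _; rewrite mxE mulrDl.
Qed.

Lemma dotpZl p q c (A B : 'M[R]_(p, q)) : dotp (c *: A) B = c * dotp A B.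
Proof.
rewrite /dotp mulr_sumr; apply: eq_bigr => i _; rewrite mulr_sumr.
by apply: eq_bigr => j _; rewrite mxE mulrA.
Qed.

Lemma dotpDr p q (A B C : 'M[R]_(p, q)) : dotp C (A + B) = dotp C A + dotp C B.
Proof. by rewrite dotpC dotpDl !(dotpC _ C). Qed.

Lemma dotpZr p q c (A B : 'M[R]_(p, q)) : dotp A (c *: B) = c * dotp A B.
Proof. by rewrite dotpC dotpZl dotpC. Qed.

Lemma dotp_ge0 p q (A : 'M[R]_(p, q)) : 0 <= dotp A A.
Proof. by do 2 (apply: sumr_ge0 => ? _); rewrite -expr2 sqr_ge0. Qed.

Lemma dotp_row p q (A B : 'M[R]_(p, q)) :
  dotp A B = \sum_i dotp (row i A) (row i B).
Proof.
apply: eq_bigr => i _; rewrite /dotp big_ord1.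
by apply: eq_bigr => j _; rewrite !mxE.
Qed.

Lemma sqr_enorm p q (A : 'M[R]_(p, q)) : enorm A ^+ 2 = dotp A A.
Proof. by rewrite sqr_sqrtr // dotp_ge0. Qed.

Lemma enorm_ge0 p q (A : 'M[R]_(p, q)) : 0 <= enorm A.
Proof. exact: sqrtr_ge0. Qed.

Lemma enormZ p q c (A : 'M[R]_(p, q)) : enorm (c *: A) = `|c| * enorm A.
Proof.
rewrite /enorm dotpZl dotpZr mulrA -expr2 sqrtrM ?sqr_ge0 //.
by rewrite sqrtr_sqr.
Qed.

Lemma enormN p q (A : 'M[R]_(p, q)) : enorm (- A) = enorm A.
Proof. by rewrite -scaleN1r enormZ normrN1 mul1r. Qed.

Lemma enorm0 p q : enorm (0 : 'M[R]_(p, q)) = 0.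
Proof. by rewrite -(scale0r 0) enormZ normr0 mul0r. Qed.

Lemma enormBC p q (A B : 'M[R]_(p, q)) : enorm (A - B) = enorm (B - A).
Proof. by rewrite -enormN opprB. Qed.

Lemma normr_entry_le_enorm p q (A : 'M[R]_(p, q)) i j : `|A i j| <= enorm A.
Proof.
rewrite -(ler_pXn2r (ltn0Sn 1)) ?nnegrE ?enorm_ge0 // sqr_enorm.
rewrite -normrX ger0_norm ?sqr_ge0 // /dotp (bigD1 i) //= (bigD1 j) //= -expr2.
rewrite -addrA lerDl addr_ge0 //; first by apply: sumr_ge0 => ? _; exact: sqr_ge0.
by apply: sumr_ge0 => ? _; apply: sumr_ge0 => ? _; exact: sqr_ge0.
Qed.

Lemma dotp_le p q (A B : 'M[R]_(p, q)) : dotp A B <= enorm A * enorm B.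
Proof.
have [eA|eA] := eqVneq (enorm A) 0.
  have A0 : A = 0.
    apply/matrixP => i j; rewrite mxE; apply/eqP.
    by rewrite -normr_le0 -eA normr_entry_le_enorm.
  by rewrite eA mul0r A0 -(scale0r 0) dotpZl mul0r.
have [eB|eB] := eqVneq (enorm B) 0.
  have B0 : B = 0.
    apply/matrixP => i j; rewrite mxE; apply/eqP.
    by rewrite -normr_le0 -eB normr_entry_le_enorm.
  by rewrite eB mulr0 B0 -(scale0r 0) dotpZr mul0r.
have A0 : 0 < enorm A by rewrite lt_def eA enorm_ge0.
have B0 : 0 < enorm B by rewrite lt_def eB enorm_ge0.
have := dotp_ge0 (enorm B *: A + (- enorm A) *: B).
rewrite !(dotpDl, dotpDr, dotpZl, dotpZr) -!sqr_enorm (dotpC B A).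
set a := enorm A in A0 *; set b := enorm B in B0 *; set x := dotp A B.
rewrite [X in 0 <= X](_ : _ = (2 * a * b) * (a * b - x)); last by ring.
by rewrite pmulr_rge0 ?subr_ge0 // !mulr_gt0.
Qed.

Lemma ler_enormD p q (A B : 'M[R]_(p, q)) : enorm (A + B) <= enorm A + enorm B.
Proof.
rewrite -(ler_pXn2r (ltn0Sn 1)) ?nnegrE ?addr_ge0 ?enorm_ge0 // sqr_enorm.
rewrite sqrrD !sqr_enorm dotpDl !dotpDr (dotpC B A) -!sqr_enorm.
have := dotp_le A B; lra.
Qed.

Lemma ler_enormB p q (A B : 'M[R]_(p, q)) : enorm (A - B) <= enorm A + enorm B.
Proof. by rewrite -(enormN B) ler_enormD. Qed.

Lemma ler_enorm_distD p q (C A B : 'M[R]_(p, q)) :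
  enorm (A - B) <= enorm (A - C) + enorm (C - B).
Proof. by rewrite (le_trans _ (ler_enormD _ _)) // addrA subrK. Qed.

Lemma enorm_le_sum p q (A : 'M[R]_(p, q)) :
  enorm A <= \sum_i \sum_j `|A i j|.
Proof.
rewrite -(ler_pXn2r (ltn0Sn 1)) ?nnegrE ?enorm_ge0 //; last first.
  by do 2 (apply: sumr_ge0 => ? _).
rewrite sqr_enorm expr2 /dotp mulr_suml; apply: ler_sum => i _.
rewrite mulr_suml; apply: ler_sum => j _.
rewrite (le_trans (ler_norm _)) // normrM ler_wpM2l //.
rewrite (bigD1 i) //= (bigD1 j) //= -addrA lerDl addr_ge0 ?sumr_ge0 //.
by move=> k _; apply: sumr_ge0.
Qed.

(** Integrals of curves are estimated entry by entry; this is where the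
    dimensional factors of the later estimates come from. *)
Lemma enorm_le_entries p q (A : 'M[R]_(p, q)) c :
  (forall i j, `|A i j| <= c) -> enorm A <= (p * q)%:R * c.
Proof.
move=> Ac; rewrite (le_trans (enorm_le_sum A)) //.
rewrite (@le_trans _ _ (\sum_(i < p) \sum_(j < q) c)) //.
  by apply: ler_sum => i _; apply: ler_sum => j _.
by rewrite !big_const_ord !iter_addr !addr0 -mulrnA mulnC mulr_natl.
Qed.

(** The row [e *m A^T] collects the scalar products of e with the rows of A. *)
Lemma enorm_mulmx_tr p q (e : 'rV[R]_q) (A : 'M[R]_(p, q)) :
  enorm (e *m A^T) <= enorm e * enorm A.
Proof.
rewrite -(ler_pXn2r (ltn0Sn 1)) ?nnegrE ?mulr_ge0 ?enorm_ge0 //.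
rewrite exprMn !sqr_enorm [X in X <= _]/dotp big_ord1 [dotp A A]dotp_row mulr_sumr.
apply: ler_sum => i _.
have -> : (e *m A^T) 0 i = dotp e (row i A).
  by rewrite mxE /dotp big_ord1; apply: eq_bigr => j _; rewrite !mxE.
rewrite -!sqr_enorm -exprMn -expr2 -real_normK ?num_real //.
rewrite ler_pXn2r ?nnegrE ?mulr_ge0 ?enorm_ge0 // ler_norml dotp_le andbT.
by rewrite lerNl -mulN1r -dotpZl (le_trans (dotp_le _ _)) // scaleN1r enormN.
Qed.

End euclidean_norm.

(** * Functions in L^2 and in W^{1,2} on an interval *)

Section sobolev.
Context {R : realType}.
Notation mu := (@lebesgue_measure R).
Implicit Types T : R.

Lemma L2_scalar_measurable T (f : R -> R) :
  L2_scalar T f -> measurable_fun `[0, T] f.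
Proof.
rewrite /L2_scalar inE => /andP[/[!inE]/= mf _].
by apply/measurable_restrictT.
Qed.

Lemma bounded_L2_scalar T (f : R -> R) (M : R) : 0 < T ->
  measurable_fun `[0, T] f -> (forall s, s \in `[0, T] -> `|f s| <= M) ->
  L2_scalar T f.
Proof.
move=> T0 mf fM.
have mF : measurable_fun setT (f \_ `[0, T]).
  exact: (measurable_restrictT f (measurable_itv `[0, T])).1.
rewrite /L2_scalar inE; apply/andP; split; rewrite inE //=.
rewrite /finite_norm unlock /=; apply: poweR_lty.
apply: (@le_lt_trans _ _ (\int[mu]_(s in `[0%R, T]) (M ^+ 2)%:E)%E).
  rewrite [leRHS]integral_mkcond ge0_le_integral //=.
  - apply/measurable_EFinP; apply: (measurableT_comp (measurable_powR _)).
    exact: measurableT_comp.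
  - exact: (measurable_restrictT (cst (M ^+ 2)%:E) (measurable_itv `[0, T])).1.
  - move=> s _; rewrite /patch; case: ifPn => [sT|_].
      rewrite lee_fin powR_mulrn // lerXn2r ?nnegrE //; last first.
        by apply: fM; move: sT; rewrite inE.
      by rewrite (le_trans (normr_ge0 (f s))) // fM //; move: sT; rewrite inE.
    by rewrite normr0 powR0.
rewrite integral_cst //= lebesgue_measure_itv /= lte_fin T0 -EFinD -EFinM.
exact: ltry.
Qed.

(** On a bounded interval an L^2 function is integrable, as its product with
    the square integrable constant 1. *)
Lemma L2_scalar_integrable T (f : R -> R) : 0 < T ->
  L2_scalar T f -> mu.-integrable `[0, T] (EFin \o f).
Proof.
move=> T0 fL.
have L1 : L2_scalar T (cst 1).
  by apply: (@bounded_L2_scalar _ _ 1) => // s _; rewrite normr1.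
have /Lfun1_integrable := Lfun2_mul_Lfun1 fL L1.
move=> H; apply/integrable_mkcond => //; apply: eq_integrable H => //= s _.
by rewrite restrict_EFin /= /patch; case: ifPn; rewrite ?mulr1 ?mulr0.
Qed.


Lemma W12_scalar_measurable T (f df : R -> R) : 0 < T ->
  W12_scalar T f df -> measurable_fun `[0, T] f.
Proof.
move=> T0 [df2 fE].
have cF : {within `[0, T], continuous
    (fun t => parameterized_integral mu 0 t df)}.
  apply: parameterized_integral_continuous; first exact: ltW.
  exact: L2_scalar_integrable.
apply: (@eq_measurable_fun _ _ _ _ _
  (fun t => f 0 + parameterized_integral mu 0 t df)).
  by move=> t; rewrite inE => tT; rewrite [RHS]fE.
apply: measurable_funD; first exact: measurable_cst.
exact: subspace_continuous_measurable_fun.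
Qed.

(** The mean value inequality of the class W^{1,2}: a bound on the derivative
    that holds throughout an interval is inherited by the increment. *)
Lemma W12_scalar_increment T (f df : R -> R) (r s c rho : R) : 0 < T ->
  W12_scalar T f df -> 0 <= r -> r <= s -> s <= T ->
  (forall t, r <= t <= s -> `|df t - c| <= rho) ->
  `|f s - f r - (s - r) * c| <= (s - r) * rho.
Proof.
move=> T0 [df2 fE] r0 rs sT dfc.
have idf := L2_scalar_integrable T0 df2.
have sub a b : 0 <= a -> b <= T -> `]a, b] `<=` `[0, T].
  move=> a0 bT x /=; rewrite !in_itv /= => /andP[ax xb].
  by rewrite (le_trans a0 (ltW ax)) (le_trans xb bT).
have idf' : mu.-integrable `]r, s] (EFin \o df).
  by apply: integrableS idf => //; exact: sub.
have icst k : mu.-integrable `]r, s] (EFin \o cst k).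
  apply: measurable_bounded_integrable => //.
    by rewrite /= lebesgue_measure_itv /=; case: ifP => // _; rewrite ltry.
  exact: bounded_cst.
have mcst k : \int[mu]_(t in `]r, s]) k = (s - r) * k.
  rewrite Rintegral_cst //= lebesgue_measure_itv /= lte_fin mulrC.
  case: ifPn => // /negbTE; rewrite lt_neqAle rs andbT => /negbFE/eqP->.
  by rewrite subrr.
have -> : f s - f r = \int[mu]_(t in `]r, s]) df t.
  have sT0 : s \in `[0, T] by rewrite in_itv /= sT (le_trans r0 rs).
  have rT0 : r \in `[0, T] by rewrite in_itv /= r0 (le_trans rs sT).
  rewrite (fE s sT0) (fE r rT0).
  rewrite opprD addrACA subrr add0r Rintegral_itvB //.
    apply: integrableS idf => //= x /=; rewrite !in_itv /= => /andP[-> xs].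
    exact: le_trans xs sT.
have idfc : mu.-integrable `]r, s] (EFin \o (fun t => df t - c)).
  rewrite (_ : EFin \o _ = (EFin \o df) \- (EFin \o cst c))%E //.
  exact: integrableB.
rewrite -mcst -RintegralB //=; last exact: icst.
apply: le_trans (le_normr_Rintegral _ idfc) _ => //=.
rewrite -mcst; apply: le_Rintegral => //=.
- exact: integrable_abse idfc.
- exact: icst.
- by move=> t; rewrite in_itv /= => /andP[rt ts]; apply: dfc; rewrite ltW.
Qed.

Lemma W12_increment T p q (f df : R -> 'M[R]_(p, q)) (r s : R) c rho : 0 < T ->
  W12 T f df -> 0 <= r -> r <= s -> s <= T ->
  (forall t, r <= t <= s -> enorm (df t - c) <= rho) ->
  enorm (f s - f r - (s - r) *: c) <= (p * q)%:R * ((s - r) * rho).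
Proof.
move=> T0 fW r0 rs sT dfc; apply: enorm_le_entries => i j.
rewrite !mxE; apply: (W12_scalar_increment T0 (fW i j)) => // t rts.
apply: le_trans (dfc t rts); have := normr_entry_le_enorm (df t - c) i j.
by rewrite !mxE.
Qed.

End sobolev.

(** * Integration along a mesh *)

Section meshes.
Context {R : realType}.
Notation mu := (@lebesgue_measure R).
Implicit Types (T : R) (N : nat) (t : nat -> R).

Lemma mesh_le T N t : mesh_points T N t ->
  forall i j, (i <= j)%N -> (j <= N)%N -> t i <= t j.
Proof.
move=> [_ _ tS] i j; elim: j => [|j IH]; first by rewrite leqn0 => /eqP->.
rewrite leq_eqVlt => /predU1P[->//|]; rewrite ltnS => ij jN.
by rewrite (le_trans (IH ij (ltnW jN))) // ltW // tS.
Qed.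

Lemma mesh_itv T N t : mesh_points T N t ->
  forall j, (j <= N)%N -> 0 <= t j <= T.
Proof.
move=> tM j jN; have [t0 tN _] := tM.
by rewrite -{1}t0 -tN (mesh_le tM (leq0n j)) // (mesh_le tM jN).
Qed.

Lemma mesh_cover T N t s : (0 < N)%N -> mesh_points T N t -> 0 <= s <= T ->
  exists2 j, (j < N)%N & t j <= s <= t j.+1.
Proof.
move=> N0 [t0 tN _] /andP[s0 sT].
suff H k : (k < N)%N -> s <= t k.+1 ->
    exists2 j, (j < N)%N & t j <= s <= t j.+1.
  by apply: (H N.-1); rewrite prednK // tN.
elim: k => [|k IH] kN sk; first by exists 0; rewrite // t0 s0.
have [sk'|/ltW ks] := lerP s (t k.+1); first exact: IH (ltnW kN) sk'.
by exists k.+1; rewrite // ks.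
Qed.

Lemma sum_mesh T N t : mesh_points T N t ->
  \sum_(j < N) (t j.+1 - t j) = T.
Proof.
move=> [t0 tN _].
by rewrite -(big_mkord xpredT (fun j => t j.+1 - t j)) telescope_sumr // tN t0 subr0.
Qed.

(** The L^2 norms over [0, T] are estimated through this comparison with the
    integral of a step function. *)
Lemma mesh_integral_le T N t (phi : R -> R) (c : nat -> R) :
  mesh_points T N t -> measurable_fun `[0, T] phi ->
  (forall s, s \in `[0, T] -> 0 <= phi s) ->
  (forall j s, (j < N)%N -> t j <= s < t j.+1 -> phi s <= c j) ->
  (\int[mu]_(s in `[0%R, T]) (phi s)%:E <=
     (\sum_(j < N) c j * (t j.+1 - t j))%:E)%E.
Proof.
move=> tM mphi phi0 phic; have [t0 tN tS] := tM.
have sub j b : (j <= N)%N ->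
    `[0, t j[ `<=` [set` Interval (BLeft (0 : R)) (BSide b T)].
  move=> jN s /=; rewrite !in_itv /= => /andP[-> st].
  have := lt_le_trans st (andP (mesh_itv tM jN)).2.
  by case: b => //= /ltW.
have mE : measurable_fun `[0, T] (EFin \o phi) by exact/measurable_EFinP.
suff H j : (j <= N)%N -> (\int[mu]_(s in `[0%R, t j[) (phi s)%:E <=
     (\sum_(i < j) c i * (t i.+1 - t i))%:E)%E.
  rewrite -integral_itv_bndo_bndc; first by rewrite -tN; exact: H.
  by apply: measurable_funS mE => //; rewrite -[in `[_, T[]tN; exact: (sub _ false).
elim: j => [_|j IH jN].
  by rewrite t0 set_itv_ge ?bnd_simp ?ltxx // integral_set0 big_ord0.
have tj0 := (andP (mesh_itv tM (ltnW jN))).1.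
rewrite (@itv_bndbnd_setU _ _ _ (BLeft (t j))) ?bnd_simp //; last exact/ltW/tS.
have S1 : `[0, t j[ `|` `[t j, t j.+1[ `<=` `[0, T].
  rewrite -itv_bndbnd_setU ?bnd_simp //; [|exact/ltW/tS].
  exact: (sub _ false).
rewrite ge0_integral_setU //=; last 3 first.
- exact: measurable_funS mE.
- by move=> s js; rewrite lee_fin; apply: phi0; exact: S1.
- apply/disj_setPS => s [] /=; rewrite !in_itv /= => /andP[_ sj] /andP[js _].
  by move: sj; rewrite ltNge js.
rewrite big_ord_recr EFinD /= leeD ?IH ?(ltnW jN) //.
apply: (@le_trans _ _ (\int[mu]_(s in `[t j, t j.+1[) cst (c j)%:E s)%E).
  apply: ge0_le_integral => //=.
  - by move=> s js; rewrite lee_fin; apply: phi0; apply: S1; right.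
  - by apply: measurable_funS mE => // s js; apply: S1; right.
  - by move=> s; rewrite in_itv /= => js; rewrite lee_fin; exact: phic.
by rewrite integral_cst //= lebesgue_measure_itv /= lte_fin tS // -EFinD -EFinM.
Qed.

End meshes.

Section norms.
Context {R : realType}.
Notation mu := (@lebesgue_measure R).
Implicit Types T : R.

Lemma L2norm_sqr T p q (F : R -> 'M[R]_(p, q)) :
  L2norm T F = ((\int[mu]_(s in `[0%R, T]) (dotp (F s) (F s))%:E) `^ 2^-1)%E.
Proof.
rewrite /L2norm unlock /=; congr (_ `^ _)%E.
rewrite [RHS]integral_mkcond; apply: eq_integral => s _ /=.
rewrite /patch; case: ifPn => _; last by rewrite normr0 powR0.
by rewrite powR_mulrn // real_normK ?num_real // sqr_enorm.
Qed.

Lemma W12norm_sqr T p q (F dF : R -> 'M[R]_(p, q)) :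
  W12norm T F dF = ((\int[mu]_(s in `[0%R, T]) (dotp (F s) (F s))%:E +
    \int[mu]_(s in `[0%R, T]) (dotp (dF s) (dF s))%:E) `^ 2^-1)%E.
Proof.
rewrite /W12norm !L2norm_sqr -!poweRrM mulVf ?pnatr_eq0 // !poweRe1 //.
- by apply: integral_ge0 => s _; rewrite lee_fin dotp_ge0.
- by apply: integral_ge0 => s _; rewrite lee_fin dotp_ge0.
Qed.

(** Square roots do not destroy convergence to 0; the squares are extended
    real since they are integrals. *)
Lemma poweR_half_cvg0 (X : nat -> \bar R) (eta : nat -> R) (C : R) :
  (forall k, (0 <= X k)%E) -> (forall k, (X k <= (C * eta k)%:E)%E) ->
  eta k @[k --> \oo] --> 0 -> ((X k) `^ 2^-1)%E @[k --> \oo] --> 0%E.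
Proof.
move=> X0 XC eta0.
have sq : Num.sqrt (C * eta k) @[k --> \oo] --> 0.
  rewrite -[0 in X in _ --> X]sqrtr0 -(mulr0 C).
  apply: (@cvg_comp _ _ _ (fun k => C * eta k) Num.sqrt); last first.
    exact: sqrt_continuous.
  by apply: cvgM => //; exact: cvg_cst.
apply: (@squeeze_cvge _ _ _ _ (cst 0%E) _ (fun k => (Num.sqrt (C * eta k))%:E)).
- apply: nearW => k; rewrite poweR_ge0 /=.
  have Ce0 : 0 <= C * eta k by rewrite -lee_fin (le_trans (X0 k)).
  rewrite -powR12_sqrt // -poweR_EFin.
  apply: gt0_ler_poweR => //;
    by rewrite ?in_itv /= ?invr_ge0 ?X0 ?leey ?lee_fin ?Ce0.
- exact: cvg_cst.
- by apply: cvg_EFin => //; apply: nearW.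
Qed.

Lemma dotp_measurable T p q (F : R -> 'M[R]_(p, q)) :
  (forall i j, measurable_fun `[0, T] (fun s => F s i j)) ->
  measurable_fun `[0, T] (fun s => dotp (F s) (F s)).
Proof.
move=> mF; apply: measurable_sum => i; apply: measurable_sum => j.
exact: measurable_funM.
Qed.

End norms.

(** * Step functions and polygons on a mesh *)

Section interpolation.
Context {R : realType}.
Notation mu := (@lebesgue_measure R).
Implicit Types (T : R) (N : nat) (t : nat -> R).

(** The value at the last node is 0, which no integral sees. *)
Definition step_function t N p q (c : nat -> 'M[R]_(p, q)) (s : R) : 'M[R]_(p, q) :=
  \sum_(j < N) \1_(`[t j, t j.+1[) s *: c j.

Definition slope t p q (y : nat -> 'M[R]_(p, q)) j : 'M[R]_(p, q) :=
  (t j.+1 - t j)^-1 *: (y j.+1 - y j).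

(** The factor [Num.min s (t j.+1) - Num.min s (t j)] is the length of the part
    of the j-th mesh interval to the left of s, so that the curve is manifestly
    an integral of [step_function t N (slope t y)]. *)
Definition polygon t N p q (y : nat -> 'M[R]_(p, q)) (s : R) : 'M[R]_(p, q) :=
  y 0%N + \sum_(j < N) (Num.min s (t j.+1) - Num.min s (t j)) *: slope t y j.

Lemma step_functionE T N t p q (c : nat -> 'M[R]_(p, q)) j s :
  mesh_points T N t -> (j < N)%N -> t j <= s < t j.+1 ->
  step_function t N c s = c j.
Proof.
move=> tM jN /andP[js sj].
rewrite /step_function (bigD1 (Ordinal jN)) //= indicE mem_set; last first.
  by rewrite /= in_itv /= js.
rewrite scale1r big1 ?addr0 // => i; rewrite -val_eqE /= => ij.
rewrite indicE memNset ?scale0r //= in_itv /= => /andP[is_ si].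
case: (ltngtP i j) ij => // [ij|ji] _.
- by have := mesh_le tM ij (ltnW jN); rewrite leNgt (le_lt_trans js si).
- by have := mesh_le tM ji (ltnW (ltn_ord i)); rewrite leNgt (le_lt_trans is_ sj).
Qed.

Lemma slopeE T N t p q (y : nat -> 'M[R]_(p, q)) j :
  mesh_points T N t -> (j < N)%N ->
  (t j.+1 - t j) *: slope t y j = y j.+1 - y j.
Proof.
move=> [_ _ tS] jN; rewrite scalerA divff ?scale1r //.
by rewrite gt_eqF // subr_gt0 tS.
Qed.

Lemma polygonE T N t p q (y : nat -> 'M[R]_(p, q)) j s :
  mesh_points T N t -> (j < N)%N -> t j <= s <= t j.+1 ->
  polygon t N y s = y j + (s - t j) *: slope t y j.
Proof.
move=> tM jN /andP[js sj]; rewrite /polygon.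
pose F l := (Num.min s (t l.+1) - Num.min s (t l)) *: slope t y l.
rewrite -(big_mkord xpredT F) (big_cat_nat (n := j)) ?(ltnW jN) //=.
rewrite [X in _ + (X + _)](@telescope_sumr_eq _ _ _ y) //; last first.
  move=> l /andP[_ lj]; rewrite /F -(slopeE y tM (ltn_trans lj jN)).
  rewrite !min_r // (le_trans _ js) //.
    exact: mesh_le tM _ _ (ltnW lj) (ltnW jN).
  exact: mesh_le tM _ _ lj (ltnW jN).
rewrite big_ltn // big_nat big1 ?addr0; last first.
  move=> l /andP[jl lN]; rewrite /F !min_l ?subrr ?scale0r // (le_trans sj) //.
    exact: mesh_le tM _ _ jl (ltnW lN).
  exact: mesh_le tM _ _ (leqW jl) lN.
by rewrite /F min_l // min_r // addrA [y 0%N + _]addrC subrK.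
Qed.

Lemma polygon0 T N t p q (y : nat -> 'M[R]_(p, q)) :
  mesh_points T N t -> polygon t N y 0 = y 0%N.
Proof.
move=> tM; rewrite /polygon big1 ?addr0 // => j _.
have j0 := (andP (mesh_itv tM (ltnW (ltn_ord j)))).1.
by rewrite !min_l ?subrr ?scale0r // (andP (mesh_itv tM (ltn_ord j))).1.
Qed.

Lemma polygon_node T N t p q (y : nat -> 'M[R]_(p, q)) j :
  mesh_points T N t -> (j <= N)%N -> polygon t N y (t j) = y j.
Proof.
move=> tM; case: j => [|j] jN; first by case: (tM) => -> _ _; exact: polygon0 tM.
rewrite (polygonE _ tM jN) ?lexx ?andbT ?(mesh_le tM) //.
by rewrite (slopeE y tM jN) addrC subrK.
Qed.

Lemma polygon_piecewise_linear T N t p q (y : nat -> 'M[R]_(p, q)) :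
  mesh_points T N t -> piecewise_linear N t (polygon t N y).
Proof.
move=> tM j s jN js; rewrite (polygonE _ tM jN js).
rewrite !(polygon_node _ tM) ?(ltnW jN) // /slope scalerA.
by [].
Qed.

Lemma step_function_piecewise_constant T N t p q (c : nat -> 'M[R]_(p, q)) :
  mesh_points T N t -> piecewise_constant N t (step_function t N c).
Proof.
move=> tM j s jN js; rewrite !(step_functionE _ tM jN) //.
by rewrite lexx; case: tM => _ _; apply.
Qed.

Lemma step_function_measurable t N p q (c : nat -> 'M[R]_(p, q)) D i j :
  measurable_fun D (fun s => step_function t N c s i j).
Proof.
rewrite (_ : (fun s => _) =
  fun s => \sum_(l < N) \1_(`[t l, t l.+1[) s * c l i j); last first.
  by apply/funext => s; rewrite summxE; apply: eq_bigr => l _; rewrite mxE.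
apply: measurable_sum => l; apply: measurable_funM; last exact: measurable_cst.
exact: measurable_indic.
Qed.

Lemma L2_step_function T N t p q (c : nat -> 'M[R]_(p, q)) : 0 < T ->
  L2 T (step_function t N c).
Proof.
move=> T0 i j; apply: (bounded_L2_scalar (M := \sum_(l < N) `|c l i j|)) => //.
  exact: step_function_measurable.
move=> s _; rewrite summxE (le_trans (ler_norm_sum _ _ _)) //.
apply: ler_sum => l _; rewrite mxE normrM indicE.
by case: (_ \in _); rewrite ?normr1 ?mul1r // normr0 mul0r.
Qed.

Lemma Rintegral_indic_itv (a b s : R) : 0 <= a -> a <= b -> 0 <= s ->
  \int[mu]_(r in `[0, s]) \1_(`[a, b[) r = Num.min s b - Num.min s a.
Proof.
move=> a0 ab s0; rewrite /Rintegral integral_indic //=.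
have [sa|as_] := ltrP s a.
  rewrite (_ : _ `&` _ = set0) ?measure0.
    by rewrite min_l ?subrr // (le_trans (ltW sa)).
  apply/seteqP; split=> // r [] /=; rewrite !in_itv /= => /andP[ar _] /andP[_ rs].
  by move: sa; rewrite ltNge (le_trans ar rs).
have [sb|bs] := ltrP s b.
  rewrite (_ : _ `&` _ = `[a, s]%classic).
    rewrite lebesgue_measure_itv /= lte_fin.
    by case: ltrP => //= sa; rewrite (@le_anti _ _ s a) ?sa ?subrr.
  apply/seteqP; split=> r /=; rewrite !in_itv /=.
    by move=> [/andP[-> _] /andP[_ ->]].
  by move=> /andP[ar rs]; rewrite ar rs (le_trans a0 ar) (le_lt_trans rs sb).
rewrite (_ : _ `&` _ = `[a, b[%classic).
  rewrite lebesgue_measure_itv /= lte_fin.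
  by case: ltrP => //= ba; rewrite (@le_anti _ _ b a) ?ba ?subrr.
apply/seteqP; split=> r /=; rewrite !in_itv /=; first by case.
move=> /andP[ar rb]; split; first by rewrite ar.
by rewrite (le_trans a0 ar) (le_trans (ltW rb) bs).
Qed.

Lemma polygon_W12 T N t p q (y : nat -> 'M[R]_(p, q)) : 0 < T ->
  mesh_points T N t ->
  W12 T (polygon t N y) (step_function t N (slope t y)).
Proof.
move=> T0 tM i j; split; first exact: L2_step_function.
move=> s; rewrite in_itv /= => /andP[s0 sT].
rewrite (polygon0 _ tM) mxE summxE; congr (_ + _).
pose G l r := \1_(`[t l, t l.+1[) r * slope t y l i j.
transitivity (\int[mu]_(r in `[0, s]) \sum_(l < N) G l r); last first.
  apply: eq_Rintegral => r _; rewrite summxE.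
  by apply: eq_bigr => l _; rewrite mxE.
have i1 l : mu.-integrable `[0, s] (EFin \o \1_(`[t l, t l.+1[)).
  apply: measurable_bounded_integrable => //.
  - by rewrite /= lebesgue_measure_itv /=; case: ifP => // _; rewrite ltry.
  - exists 1; split; first exact: num_real.
    move=> M M1 r _ /=; rewrite (le_trans _ (ltW M1)) // indicE.
    by case: (_ \in _); rewrite ?normr1 // normr0.
have iG l : mu.-integrable `[0, s] (EFin \o G l).
  have := integrableZr _ (slope t y l i j) (i1 l).
  by move=> /(_ (measurable_itv _)); apply: eq_integrable.
suff: forall n, (n <= N)%N ->
    mu.-integrable `[0, s] (EFin \o (fun r => \sum_(l < n) G l r)) /\
  \sum_(l < n) ((Num.min s (t l.+1) - Num.min s (t l)) *: slope t y l) i j =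
  \int[mu]_(r in `[0, s]) \sum_(l < n) G l r.
  by case/(_ N (leqnn N)).
elim=> [_|n IH nN].
  rewrite big_ord0; split.
    by apply: eq_integrable (integrable0 _ _) => // r _ /=; rewrite big_ord0.
  by under eq_Rintegral do rewrite big_ord0; rewrite Rintegral_cst // mul0r.
have [In En] := IH (ltnW nN).
have EF : (fun r => \sum_(l < n.+1) G l r) =
    (fun r => \sum_(l < n) G l r + G n r).
  by apply/funext => r; rewrite big_ord_recr.
rewrite EF big_ord_recr /= RintegralD // -En RintegralZr //; split.
  rewrite (_ : EFin \o _ =
    ((EFin \o (fun r => \sum_(l < n) G l r)%R) \+ (EFin \o G n))%E) //.
  exact: integrableD.
have tn0 := (andP (mesh_itv tM (ltnW nN))).1.
by rewrite Rintegral_indic_itv ?(mesh_le tM) // mxE.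
Qed.

End interpolation.

(** * Convergence from summable oscillations *)

Section convergence.
Context {R : realType}.
Notation mu := (@lebesgue_measure R).
Implicit Types (T eta Q : R) (N : nat) (t : nat -> R).

Lemma measurable_entryB D p q (F G : R -> 'M[R]_(p, q)) i j :
  measurable_fun D (fun s => F s i j) -> measurable_fun D (fun s => G s i j) ->
  measurable_fun D (fun s => (F s - G s) i j).
Proof.
move=> mF mG; rewrite (_ : (fun s => _) = fun s => F s i j - G s i j).
  exact: measurable_funB.
by apply/funext => s; rewrite !mxE.
Qed.

(** The single source of convergence: if an error is at most [c j] on the j-th
    mesh interval and Q does not depend on the mesh, then its L^2 norm is of the
    order of the square root of the mesh size, because [c j ^+ 2 <= Q * c j]. *)
Lemma mesh_sqr_integral_le T N t p q (F : R -> 'M[R]_(p, q)) (c : nat -> R) eta Q :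
  (0 < N)%N -> mesh_points T N t ->
  (forall i j, measurable_fun `[0, T] (fun s => F s i j)) ->
  (forall j s, (j < N)%N -> t j <= s < t j.+1 -> enorm (F s) <= c j) ->
  (forall j, (j < N)%N -> t j.+1 - t j <= eta) ->
  \sum_(j < N) c j <= Q ->
  (\int[mu]_(s in `[0%R, T]) (dotp (F s) (F s))%:E <= (Q ^+ 2 * eta)%:E)%E.
Proof.
move=> N0 tM mF Fc teta cQ; have [_ _ tS] := tM.
have c0 j : (j < N)%N -> 0 <= c j.
  move=> jN; apply: le_trans (enorm_ge0 (F (t j))) _; apply: Fc => //.
  by rewrite lexx tS.
apply: le_trans (mesh_integral_le (c := fun j => c j ^+ 2) tM _ _ _) _ => /=.
- exact: dotp_measurable.
- by move=> s _; exact: dotp_ge0.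
- move=> j s jN js; rewrite -sqr_enorm ler_pXn2r ?nnegrE ?enorm_ge0 ?c0 //.
  exact: Fc js.
rewrite lee_fin expr2 -mulrA.
have cQ' j : (j < N)%N -> c j <= Q.
  move=> jN; apply: le_trans cQ; rewrite (bigD1 (Ordinal jN)) //= lerDl.
  by apply: sumr_ge0 => i _; exact: c0.
have Q0 : 0 <= Q := le_trans (c0 0%N N0) (cQ' 0%N N0).
have eta0 : 0 <= eta by rewrite (le_trans _ (teta 0%N N0)) // subr_ge0 ltW // tS.
apply: (@le_trans _ _ (\sum_(j < N) c j * (Q * eta))); last first.
  by rewrite -mulr_suml ler_wpM2r // mulr_ge0.
apply: ler_sum => j _; rewrite expr2 -mulrA ler_wpM2l ?c0 //.
by rewrite ler_pM ?c0 ?cQ' ?teta // subr_ge0 ltW // tS.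
Qed.

(** The deviation of a polygon from a W^{1,2} curve is the integral of the error
    of the slopes, hence of the order of the mesh size. *)
Lemma polygon_error T N t p q (f df : R -> 'M[R]_(p, q)) y (c : nat -> R) eta Q s :
  0 < T -> (0 < N)%N -> mesh_points T N t -> W12 T f df -> y 0%N = f 0 ->
  (forall j r, (j < N)%N -> t j <= r <= t j.+1 ->
    enorm (slope t y j - df r) <= c j) ->
  (forall j, (j < N)%N -> t j.+1 - t j <= eta) ->
  \sum_(j < N) c j <= Q -> 0 <= s <= T ->
  enorm (polygon t N y s - f s) <= (p * q)%:R * (Q * eta).
Proof.
move=> T0 N0 tM fW y0 dfc teta cQ sT; have [t0 tN tS] := tM.
have c0 j : (j < N)%N -> 0 <= c j.
  move=> jN; apply: le_trans (enorm_ge0 (slope t y j - df (t j))) _.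
  by apply: dfc => //; rewrite lexx ltW // tS.
have eta0 : 0 <= eta by rewrite (le_trans _ (teta 0%N N0)) // subr_ge0 ltW // tS.
pose S n := \sum_(i < n) c i.
have step j r : (j < N)%N -> t j <= r <= t j.+1 ->
    enorm (y j - f (t j)) <= (p * q)%:R * (S j * eta) ->
    enorm (polygon t N y r - f r) <= (p * q)%:R * (S j.+1 * eta).
  move=> jN /andP[jr rj] IH.
  rewrite (polygonE y tM jN) ?jr //.
  have -> : y j + (r - t j) *: slope t y j - f r =
      (y j - f (t j)) - (f r - f (t j) - (r - t j) *: slope t y j).
    by apply/matrixP => i i'; rewrite !mxE; ring.
  apply: le_trans (ler_enormB _ _) _.
  rewrite /S big_ord_recr /= mulrDl mulrDr lerD //.
  have tj0 := (andP (mesh_itv tM (ltnW jN))).1.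
  have tjT := (andP (mesh_itv tM jN)).2.
  apply: le_trans (W12_increment (rho := c j) T0 fW tj0 jr (le_trans rj tjT) _) _.
    move=> r' /andP[jr' r'r]; rewrite enormBC dfc // jr' (le_trans r'r) //.
  rewrite ler_wpM2l // mulrC ler_wpM2l ?c0 // (le_trans _ (teta j jN)) //.
  by rewrite lerD2r.
have node j : (j <= N)%N -> enorm (y j - f (t j)) <= (p * q)%:R * (S j * eta).
  elim: j => [_|j IH jN].
    by rewrite t0 y0 subrr enorm0 /S big_ord0 mul0r mulr0.
  rewrite -{1}(polygon_node y tM jN); apply: step => //; last exact: IH (ltnW jN).
  by rewrite lexx andbT ltW // tS.
have [j jN js] := mesh_cover N0 tM sT.
apply: le_trans (step j s jN js (node j (ltnW jN))) _.
rewrite ler_wpM2l // ler_wpM2r // (le_trans _ cQ) // /S.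
rewrite -!(big_mkord xpredT c) [X in _ <= X](big_cat_nat (n := j.+1)) //= lerDl.
by rewrite big_nat sumr_ge0 // => i /andP[_]; exact: c0.
Qed.

(** In the W^{1,2} norm the part of the derivatives is of the order of the
    square root of the mesh size, and the part of the curves themselves is
    smaller by [polygon_error]. *)
Lemma W12_cvg_polygon T p q (f df : R -> 'M[R]_(p, q)) (N : nat -> nat)
    (t : nat -> nat -> R) (y : nat -> nat -> 'M[R]_(p, q)) (c : nat -> nat -> R)
    (eta : nat -> R) Q M :
  0 < T -> (forall k, (0 < N k)%N) -> (forall k, mesh_points T (N k) (t k)) ->
  W12 T f df -> (forall k, y k 0%N = f 0) ->
  (forall k j r, (j < N k)%N -> t k j <= r <= t k j.+1 ->
    enorm (slope (t k) (y k) j - df r) <= c k j) ->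
  (forall k j, (j < N k)%N -> t k j.+1 - t k j <= eta k) ->
  (forall k, \sum_(j < N k) c k j <= Q) ->
  (forall k, eta k <= M) -> eta k @[k --> \oo] --> 0 ->
  W12_cvg T (fun k => polygon (t k) (N k) (y k)) f.
Proof.
move=> T0 N0 tM fW y0 dfc teta cQ etaM eta0.
exists (fun k => step_function (t k) (N k) (slope (t k) (y k))), df; split=> //.
  by move=> k; exact: polygon_W12.
under eq_fun do rewrite W12norm_sqr.
pose D : R := (p * q)%:R.
apply: (poweR_half_cvg0 (C := T * (D * Q) ^+ 2 * M + Q ^+ 2) _ _ eta0).
  by move=> k; apply: adde_ge0; apply: integral_ge0 => s _; rewrite lee_fin dotp_ge0.
move=> k; rewrite mulrDl EFinD; apply: leeD; last first.
  apply: (mesh_sqr_integral_le (N0 k) (tM k) _ _ (teta k) (cQ k)).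
    move=> i j; apply: measurable_entryB; first exact: step_function_measurable.
    exact: L2_scalar_measurable (fW i j).1.
  move=> j s jN js; rewrite (step_functionE _ (tM k)  jN js) dfc //.
  by case/andP: js => -> /ltW.
have eta_ge0 : 0 <= eta k.
  by rewrite (le_trans _ (teta k 0%N (N0 k))) // subr_ge0 (mesh_le (tM k)).
pose E2 (j : nat) := (D * (Q * eta k)) ^+ 2.
apply: le_trans (mesh_integral_le (c := E2) (tM k) _ _ _) _ => /=.
- apply: dotp_measurable => i j; apply: measurable_entryB;
    last exact: W12_scalar_measurable (fW i j).
  exact: W12_scalar_measurable (polygon_W12 (y k) T0 (tM k) i j).
- by move=> s _; exact: dotp_ge0.
- move=> j s jN /andP[js sj].
  have sT : 0 <= s <= T.
    rewrite (le_trans (andP (mesh_itv (tM k) (ltnW jN))).1 js).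
    by rewrite (le_trans (ltW sj)) // (andP (mesh_itv (tM k) jN)).2.
  have E := polygon_error T0 (N0 k) (tM k) fW (y0 k) (dfc k) (teta k) (cQ k) sT.
  by rewrite -sqr_enorm ler_pXn2r ?nnegrE ?enorm_ge0 // (le_trans _ E) ?enorm_ge0.
rewrite -mulr_sumr (sum_mesh (tM k)) lee_fin.
have -> : (D * (Q * eta k)) ^+ 2 * T = T * (D * Q) ^+ 2 * eta k * eta k by ring.
by rewrite ler_wpM2r // ler_wpM2l // mulr_ge0 ?sqr_ge0 // ltW.
Qed.

Lemma L2_cvg_step_function T p q (f : R -> 'M[R]_(p, q)) (N : nat -> nat)
    (t : nat -> nat -> R) (y : nat -> nat -> 'M[R]_(p, q)) (c : nat -> nat -> R)
    (eta : nat -> R) Q :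
  0 < T -> (forall k, (0 < N k)%N) -> (forall k, mesh_points T (N k) (t k)) ->
  L2 T f ->
  (forall k j r, (j < N k)%N -> t k j <= r <= t k j.+1 ->
    enorm (y k j - f r) <= c k j) ->
  (forall k j, (j < N k)%N -> t k j.+1 - t k j <= eta k) ->
  (forall k, \sum_(j < N k) c k j <= Q) -> eta k @[k --> \oo] --> 0 ->
  L2_cvg T (fun k => step_function (t k) (N k) (y k)) f.
Proof.
move=> T0 N0 tM fL fc teta cQ eta0; split=> // [k|]; first exact: L2_step_function.
under eq_fun do rewrite L2norm_sqr.
apply: (poweR_half_cvg0 (C := Q ^+ 2) _ _ eta0) => k.
  by apply: integral_ge0 => s _; rewrite lee_fin dotp_ge0.
apply: (mesh_sqr_integral_le (N0 k) (tM k) _ _ (teta k) (cQ k)).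
  move=> i j; apply: measurable_entryB; first exact: step_function_measurable.
  exact: L2_scalar_measurable (fL i j).
move=> j s jN js; rewrite (step_functionE _ (tM k) jN js) fc //.
by case/andP: js => -> /ltW.
Qed.

End convergence.

(** * Bounded variation, choice of the nodes, Gronwall's lemma, normal cones *)

Section ingredients.
Context {R : realType}.
Notation mu := (@lebesgue_measure R).
Implicit Types (T : R) (N : nat) (t : nat -> R).

(** W is the sum of the variation functions of the entries.  The increments of
    W bound the oscillation of f on the mesh intervals, and their sum telescopes
    to a bound independent of the mesh. *)
Lemma bv_modulus T p q (f : R -> 'M[R]_(p, q)) (K : R) :
  (etotal_variation f 0 T <= K%:E)%E ->
  exists W : R -> R, forall r s, 0 <= r -> r <= s -> s <= T ->
    enorm (f s - f r) <= W s - W r.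
Proof.
move=> fK; pose F i j s := f s i j.
have FK i j : (total_variation 0 T (F i j) <= K%:E)%E.
  apply: le_trans fK; apply: ge_ereal_sup => _ [_ [s sP <-] <-].
  apply: le_ereal_sup_tmp; exists (evariation f 0 T s)%:E.
    by exists (evariation f 0 T s) => //; exists s.
  rewrite lee_fin; apply: ler_sum => k _ /=.
  have := normr_entry_le_enorm
    (f (nth T (0 :: s) k.+1) - f (nth T (0 :: s) k)) i j.
  by rewrite !mxE.
have fin i j s : 0 <= s -> s <= T -> total_variation 0 s (F i j) \is a fin_num.
  move=> s0 sT; rewrite ge0_fin_numE ?total_variation_ge0 //.
  apply: le_lt_trans (ltry K); apply: le_trans (FK i j).
  by rewrite (total_variationD _ s0 sT) leeDl // total_variation_ge0.
exists (fun s => \sum_i \sum_j fine (total_variation 0 s (F i j))).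
move=> r s r0 rs sT; rewrite (le_trans (enorm_le_sum _)) // -sumrB.
apply: ler_sum => i _; rewrite -sumrB; apply: ler_sum => j _.
have s0 := le_trans r0 rs.
rewrite !mxE -[_ - f r i j]/(F i j s - F i j r) lerBrDl -lee_fin.
rewrite EFinD !fineK ?fin // ?(le_trans rs) //.
by rewrite (total_variationD _ r0 rs) leeD2l // total_variation_ge.
Qed.

Lemma ae_itv_exists (A : R -> Prop) (a b : R) : a < b ->
  {ae mu, forall s, A s} -> exists2 s, a < s < b & A s.
Proof.
move=> ab [Z [mZ Z0 AZ]]; apply: contrapT => nA.
have abZ : `]a, b[ `<=` Z.
  move=> s; rewrite /= in_itv /= => abs; apply: AZ => As; apply: nA.
  by exists s.
have : (mu `]a, b[ <= 0)%E.
  by rewrite -Z0; apply: le_measure; rewrite ?inE //; exact: measurable_itv.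
by rewrite lebesgue_measure_itv /= lte_fin ab -EFinD lee_fin leNgt subr_gt0 ab.
Qed.

(** Each inner node is chosen in the left half of an interval of the uniform mesh
    of size T / N; such a half has positive measure, so it contains a point of A,
    and consecutive nodes stay at a distance less than 2 T / N. *)
Lemma mesh_in_ae T N (A : R -> Prop) : 0 < T -> (0 < N)%N ->
  {ae mu, forall s, A s} ->
  exists t, [/\ mesh_points T N t,
    forall j, (0 < j < N)%N -> A (t j) &
    forall j, (j < N)%N -> t j.+1 - t j <= 2 * T / N%:R].
Proof.
move=> T0 N0 aeA; pose h := T / N%:R.
have N0' : 0 < N%:R :> R by rewrite ltr0n.
have h0 : 0 < h by rewrite divr_gt0.
have hN : h * N%:R = T by rewrite divfK // gt_eqF.
have ex j : exists s, (j%:R * h < s < j%:R * h + h / 2) /\ A s.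
  have jh : j%:R * h < j%:R * h + h / 2 by rewrite ltrDl divr_gt0.
  by have [s sj As] := ae_itv_exists jh aeA; exists s.
have [z zP] := choice ex.
(* The end points of the mesh are imposed, whether or not A holds there. *)
exists (fun j => if j == 0%N then 0 else if j == N then T else z j); split.
- split=> [||j jN]; rewrite ?eqxx //.
    by rewrite gtn_eqF.
  have [/andP[z1 z2] _] := zP j.+1; have [/andP[z3 z4] _] := zP j.
  rewrite /= (ltn_eqF jN).
  have jle : (j.+1%:R : R) * h <= T by rewrite -hN mulrC ler_wpM2l ?ler_nat // ltW.
  rewrite -natr1 mulrDl mul1r in z1 z2 jle.
  have j0h : 0 <= j%:R * h by rewrite mulr_ge0 // ltW.
  case: (eqVneq j 0%N) => [j0|j0]; case: (eqVneq j.+1 N) => jN1 //; lra.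
- by move=> j /andP[j0 jN]; rewrite gtn_eqF // ltn_eqF //; case: (zP j).
- move=> j jN; rewrite /= (ltn_eqF jN) -mulrA -/h.
  have [/andP[z1 z2] _] := zP j.+1; have [/andP[z3 z4] _] := zP j.
  rewrite -natr1 mulrDl mul1r in z1 z2.
  case: (eqVneq j.+1 N) => jN1.
    have : T = j%:R * h + h by rewrite -hN -jN1 -natr1; ring.
    case: (eqVneq j 0%N) => [->|j0]; rewrite ?mul0r; lra.
  case: (eqVneq j 0%N) => [j0|j0]; last lra.
  by move: z1 z2; rewrite j0 mul0r; lra.
Qed.

(** Gronwall's lemma for variable step sizes.  The bound eta of the steps is
    taken out of the sum of the [h j * w j], because the defects w are only
    known to be summable. *)
Lemma discrete_gronwall (E h w : nat -> R) (L eta : R) N : 0 <= L ->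
  E 0%N = 0 ->
  (forall j, (j < N)%N -> 0 <= h j <= eta) ->
  (forall j, (j < N)%N -> 0 <= w j) ->
  (forall j, (j < N)%N -> E j.+1 <= E j + h j * (w j + L * E j)) ->
  forall j, (j <= N)%N ->
    E j <= expR (L * \sum_(i < j) h i) * (eta * \sum_(i < j) w i).
Proof.
move=> L0 E0 h0 w0 ES; elim=> [_|j IH jN].
  by rewrite E0 !big_ord0 !mulr0.
have /andP[hj0 hje] := h0 j jN; have wj := w0 j jN.
have {}IH := IH (ltnW jN).
apply: le_trans (ES j jN) _.
rewrite !big_ord_recr /= (mulrDr L) expRD.
set H := \sum_(i < j) h i in IH *; set S := \sum_(i < j) w i in IH *.
have H0 : 0 <= H.
  apply: sumr_ge0 => i _.
  by have /andP[] := h0 i (ltn_trans (ltn_ord i) jN).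
have S0 : 0 <= S by apply: sumr_ge0 => i _; exact/w0/(ltn_trans (ltn_ord i) jN).
have e1 : 1 <= expR (L * H) by rewrite -expR0 ler_expR mulr_ge0.
have e2 : 1 + L * h j <= expR (L * h j) by apply: expR_ge1Dx.
have Lh : 0 <= L * h j by rewrite mulr_ge0.
have eta0 := le_trans hj0 hje.
set a := expR (L * H) in IH e1 *; set b := expR (L * h j) in e2 *.
apply: (@le_trans _ _ ((1 + L * h j) * (a * (eta * S)) + h j * w j)).
  rewrite (_ : E j + _ = (1 + L * h j) * E j + h j * w j); last by ring.
  by rewrite lerD2r ler_wpM2l // addr_ge0.
rewrite [X in _ <= _ * X]mulrDr mulrDr lerD //.
  by rewrite -mulrA mulrCA ler_wpM2l ?ler_wpM2r ?mulr_ge0 // (le_trans ler01).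
rewrite (le_trans (_ : _ <= eta * w j)) ?ler_wpM2r // ler_peMl ?mulr_ge0 //.
by rewrite mulr_ege1 // (le_trans _ e2) // lerDl.
Qed.

(** The shifted right-hand sides describe the polyhedron translated by e, and
    normal cones are invariant under translations. *)
Lemma normal_cone_translate n m (x e v : 'rV[R]_n) (a : 'M[R]_(m, n)) b :
  normal_cone x (polyhedron a b) v ->
  normal_cone (x + e) (polyhedron a (b + e *m a^T)) v.
Proof.
have eE i : (e *m a^T) 0 i = dotp (row i a) e.
  rewrite mxE /dotp big_ord1; apply: eq_bigr => k _; by rewrite !mxE mulrC.
move=> [xC vN]; split=> [i|y yC].
  by rewrite dotpDr mxE eE lerD2r.
have := vN (y - e); rewrite -addrA -opprD [e + x]addrC; apply => i.
have := yC i; rewrite mxE eE dotpDr -scaleN1r dotpZr mulN1r; lra.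
Qed.

Lemma normal_cone0 n (x : 'rV[R]_n) (C : set 'rV[R]_n) :
  C x -> normal_cone x C 0.
Proof. by move=> Cx; split=> // y _; rewrite -(scale0r 0) dotpZl mul0r. Qed.

End ingredients.

(** * The discrete sweeping process *)

Section scheme.
Context {R : realType}.
Implicit Types (T eta L : R) (N : nat) (t : nat -> R).

Lemma slope_error T N t p q (f df : R -> 'M[R]_(p, q)) j c rho : 0 < T ->
  mesh_points T N t -> W12 T f df -> (j < N)%N ->
  (forall r, t j <= r <= t j.+1 -> enorm (df r - c) <= rho) ->
  enorm (slope t (f \o t) j - c) <= (p * q)%:R * rho.
Proof.
move=> T0 tM fW jN dfc; have [_ _ tS] := tM.
have h0 : 0 < t j.+1 - t j by rewrite subr_gt0 tS.
rewrite -(ler_pM2l h0) -{1}[t j.+1 - t j]gtr0_norm // -enormZ scalerBr.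
rewrite (slopeE _ tM jN) mulrCA /=; apply: (W12_increment T0 fW _ _ _ dfc).
- exact: (andP (mesh_itv tM (ltnW jN))).1.
- exact/ltW/tS.
- exact: (andP (mesh_itv tM jN)).2.
Qed.

Lemma slopeD t p q (y z : nat -> 'M[R]_(p, q)) j :
  slope t (fun i => y i + z i) j = slope t y j + slope t z j.
Proof. by rewrite /slope -scalerDr opprD addrACA. Qed.

(** The discrete product rule. *)
Lemma slope_mulmx_tr t p q (e : nat -> 'rV[R]_q) (a : nat -> 'M[R]_(p, q)) j :
  slope t (fun i => e i *m (a i)^T) j =
  e j.+1 *m (slope t a j)^T + slope t e j *m (a j)^T.
Proof.
have -> : (slope t a j)^T = (t j.+1 - t j)^-1 *: ((a j.+1)^T - (a j)^T).
  by apply/matrixP => k l; rewrite !mxE.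
by rewrite /slope -scalemxAr -scalemxAl -scalerDr mulmxBr mulmxBl addrA subrK.
Qed.

(** If the velocity of the scheme misses the velocity of the trajectory by a
    summable defect and by a multiple of the current deviation, then the
    deviation is of the order of the mesh size. *)
Lemma deviation_le T N t n (x dx : R -> 'rV[R]_n) (X : nat -> 'rV[R]_n)
    (w : nat -> R) eta L Q : 0 < T -> 0 <= L ->
  mesh_points T N t -> W12 T x dx -> X 0%N = x 0 ->
  (forall j, (j < N)%N -> t j.+1 - t j <= eta) ->
  (forall j, (j < N)%N -> 0 <= w j) -> \sum_(j < N) w j <= Q ->
  (forall j r, (j < N)%N -> t j <= r <= t j.+1 ->
    enorm (slope t X j - dx r) <= w j + L * enorm (X j - x (t j))) ->
  forall j, (j <= N)%N ->
    enorm (X j - x (t j)) <= expR (n%:R * L * T) * (n%:R * Q) * eta.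
Proof.
move=> T0 L0 tM xW X0 teta w0 wQ Xdx j jN; have [t0 tN tS] := tM.
pose h i := t i.+1 - t i.
have ES i : (i < N)%N -> enorm (X i.+1 - x (t i.+1)) <=
    enorm (X i - x (t i)) + h i * (n%:R * w i + n%:R * L * enorm (X i - x (t i))).
  move=> iN; set E := enorm (X i - x (t i)) in Xdx *.
  have -> : X i.+1 - x (t i.+1) = (X i - x (t i)) -
      (x (t i.+1) - x (t i) - h i *: slope t X i).
    by rewrite (slopeE X tM iN); apply/matrixP => k l; rewrite !mxE; ring.
  apply: le_trans (ler_enormB _ _) _; rewrite lerD2l.
  have := W12_increment (c := slope t X i)
    (rho := w i + L * enorm (X i - x (t i))) T0 xW
    (andP (mesh_itv tM (ltnW iN))).1 (ltW (tS i iN)) (andP (mesh_itv tM iN)).2.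
  rewrite mul1n => /(_ _)/le_trans; apply.
    by move=> r ri; rewrite enormBC Xdx.
  by rewrite -/(h i) mulrCA -mulrA -mulrDr -/E lexx.
have teta' i : (i < N)%N -> 0 <= h i <= eta.
  by move=> iN; rewrite teta // subr_ge0 ltW // tS.
have E0 : enorm (X 0%N - x (t 0%N)) = 0 by rewrite t0 X0 subrr enorm0.
have nw0 i : (i < N)%N -> 0 <= n%:R * w i by move=> iN; rewrite mulr_ge0 ?w0.
have := discrete_gronwall (E := fun i => enorm (X i - x (t i)))
  (mulr_ge0 (ler0n R n) L0) E0 teta' nw0 ES jN.
have N0 : (0 < N)%N.
  by rewrite lt0n; apply/eqP => N0; move: T0; rewrite -tN N0 t0 ltxx.
have eta0 : 0 <= eta by have /andP[h0] := teta' 0%N N0; exact: le_trans.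
have Q0 : 0 <= Q by rewrite (le_trans _ wQ) // sumr_ge0 // => i _; exact: w0.
move/le_trans; apply; rewrite -mulr_sumr -mulrA.
rewrite ler_pM ?expR_ge0 //.
- rewrite !mulr_ge0 // sumr_ge0 // => i _; apply: w0; exact: leq_trans jN.
- rewrite ler_expR ler_wpM2l ?mulr_ge0 //.
  rewrite -(big_mkord xpredT h) telescope_sumr // t0 subr0.
  exact: (andP (mesh_itv tM jN)).2.
- rewrite mulrC ler_wpM2r // ler_wpM2l // (le_trans _ wQ) //.
  rewrite -!(big_mkord xpredT w) [X in _ <= X](big_cat_nat (n := j)) //= lerDl.
  by rewrite big_nat sumr_ge0 // => i /andP[_]; exact: w0.
Qed.

Lemma enorm_unit_rows p q (A : 'M[R]_(p, q)) :
  (forall i, enorm (row i A) = 1) -> enorm A = Num.sqrt p%:R.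
Proof.
move=> A1; rewrite /enorm dotp_row; congr Num.sqrt.
under eq_bigr do rewrite -sqr_enorm A1 expr1n.
by rewrite big_const_ord iter_addr addr0.
Qed.

Fixpoint euler t n (velocity : nat -> 'rV[R]_n -> 'rV[R]_n) (x0 : 'rV[R]_n) j :=
  if j is i.+1 then
    let xi := euler t velocity x0 i in
    xi + (t i.+1 - t i) *: velocity i xi
  else x0.

Lemma slope_euler T N t n (velocity : nat -> 'rV[R]_n -> 'rV[R]_n) x0 j :
  mesh_points T N t -> (j < N)%N ->
  slope t (euler t velocity x0) j = velocity j (euler t velocity x0 j).
Proof.
move=> [_ _ tS] jN; rewrite /slope /= addrAC subrr add0r scalerA mulVf ?scale1r //.
by rewrite gt_eqF // subr_gt0 tS.
Qed.

(** The discrete trajectory.  The normals [a] are sampled at the nodes, the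
    states X follow an Euler scheme, and the right-hand sides B are shifted so
    that the discrete polyhedron at X j is the polyhedron at [x (t j)] translated
    by [X j - x (t j)].  At an inner node the two normal cones are therefore
    equal, and the velocity
      [dx (t j) + g (X j) (u (t j)) - g (x (t j)) (u (t j))]
    is admissible for X j because [dx (t j)] is admissible for [x (t j)].  At
    the node 0 no inclusion is available; there the normal vector 0 is used with
    an arbitrary control u0, at the price of one bounded error on one interval.
    Apart from that, all velocities differ from those of the given trajectory by
    oscillations of dx, da, db and u, whose sum over the mesh is bounded, and by
    multiples of the deviation, which is of the order of the mesh size by
    [deviation_le].  So the total Q of the errors does not depend on the mesh. *)
Lemma tracking_scheme T n m d (g : 'rV[R]_n -> 'rV[R]_d -> 'rV[R]_n)
    (U : set 'rV[R]_d) (x dx : R -> 'rV[R]_n) (a da : R -> 'M[R]_(m, n))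
    (b db : R -> 'rV[R]_m) (u : R -> 'rV[R]_d) (W : R -> R) (u0 : 'rV[R]_d) L :
  0 < T -> W12 T x dx -> W12 T a da -> W12 T b db ->
  (forall r s, 0 <= r -> r <= s -> s <= T ->
    [/\ enorm (dx s - dx r) <= W s - W r, enorm (da s - da r) <= W s - W r,
        enorm (db s - db r) <= W s - W r & enorm (u s - u r) <= W s - W r]) ->
  0 < L -> (forall x1 x2 u1 u2, U u1 -> U u2 ->
    enorm (g x1 u1 - g x2 u2) <= L * (enorm (x1 - x2) + enorm (u1 - u2))) ->
  polyhedron (a 0) (b 0) (x 0) ->
  (forall s i, s \in `[0, T] -> enorm (row i (a s)) = 1) ->
  exists Q, forall N t, (0 < N)%N -> mesh_points T N t ->
    (forall j, (j < N)%N -> t j.+1 - t j <= 2 * T / N%:R) ->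
    (forall j, (0 < j < N)%N -> U (u (t j)) /\
      [set - v + g (x (t j)) (u (t j)) |
        v in normal_cone (x (t j)) (polyhedron (a (t j)) (b (t j)))] (dx (t j))) ->
    exists (X : nat -> 'rV[R]_n) (B : nat -> 'rV[R]_m) (V : nat -> 'rV[R]_d)
      (c : nat -> R),
    [/\ X 0%N = x 0, B 0%N = b 0,
        (forall j, (j < N)%N ->
          sweep_map g (X j) (a (t j)) (B j) (V j) (- slope t X j)),
        (forall j r, (j < N)%N -> t j <= r <= t j.+1 ->
          [/\ enorm (slope t X j - dx r) <= c j,
              enorm (slope t (a \o t) j - da r) <= c j,
              enorm (slope t B j - db r) <= c j &
              enorm (V j - u r) <= c j]) &
        \sum_(j < N) c j <= Q].
Proof.
move=> T0 xW aW bW WP L0 gL x0C a1.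
have W_mono r s : 0 <= r -> r <= s -> s <= T -> W r <= W s.
  move=> r0 rs sT; have [h _ _ _] := WP r s r0 rs sT.
  by rewrite -subr_ge0 (le_trans _ h) // enorm_ge0.
(* The defect caused by the arbitrary choice of velocity and control at 0. *)
pose C0 := enorm (g (x 0) u0 - dx 0) + enorm (u0 - u 0).
have C00 : 0 <= C0 by rewrite addr_ge0 ?enorm_ge0.
pose Qw := W T - W 0 + C0.
have WT : 0 <= W T - W 0 by rewrite subr_ge0 W_mono // ltW.
have Qw0 : 0 <= Qw by rewrite addr_ge0.
(* The deviation is at most G times the mesh size, and A1 bounds the slopes of
   the sampled normals. *)
pose G := expR (n%:R * L * T) * (n%:R * Qw).
have G0 : 0 <= G by rewrite !mulr_ge0 // expR_ge0.
pose Da : R := (m * n)%:R.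
pose Db : R := (1 * m)%:R.
have Da0 : 0 <= Da := ler0n _ _.
have Db0 : 0 <= Db := ler0n _ _.
pose A1 := Da * Qw + (enorm (da 0) + Qw).
have A10 : 0 <= A1.
  by rewrite addr_ge0 ?(mulr_ge0 Da0 Qw0) // (addr_ge0 (enorm_ge0 _) Qw0).
(* The error of the right-hand sides is k1 times the oscillation plus k2 times
   the mesh size, by the product rule for the shift; C dominates the
   coefficients of all four errors. *)
pose k1 := Db + n%:R * Num.sqrt m%:R.
pose k2 := G * A1 + n%:R * (L * G) * Num.sqrt m%:R.
have k10 : 0 <= k1 by rewrite (addr_ge0 Db0) // mulr_ge0 ?sqrtr_ge0.
have LG0 : 0 <= L * G by rewrite mulr_ge0 // ltW.
have k20 : 0 <= k2.
  by rewrite (addr_ge0 (mulr_ge0 G0 A10)) // mulr_ge0 ?sqrtr_ge0 // (mulr_ge0 _ LG0).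
pose C := 1 + L * G + Da + k1 + k2.
have C_1 : 1 <= C by rewrite /C; lra.
have C_L : L * G <= C by rewrite /C; lra.
have C_a : Da <= C by rewrite /C; lra.
have C_k1 : k1 <= C by rewrite /C; lra.
have C_k2 : k2 <= C by rewrite /C; lra.
have C_0 : 0 <= C by lra.
exists (C * (Qw + 2 * T)) => N t N0 tM teta tA.
have [t0 tN tS] := tM; pose eta := 2 * T / N%:R.
have eta0 : 0 <= eta by rewrite !mulr_ge0 ?invr_ge0 // ltW.
pose V j := if j is 0%N then u0 else u (t j).
pose vel j y := if j is 0%N then g y u0 else
  dx (t j) + g y (u (t j)) - g (x (t j)) (u (t j)).
pose X := euler t vel (x 0).
pose e j := X j - x (t j).
pose B j := b (t j) + e j *m (a (t j))^T.
pose w j := W (t j.+1) - W (t j) + (if j is 0%N then C0 else 0).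
have jtT j r : (j < N)%N -> t j <= r <= t j.+1 ->
    [/\ 0 <= t j, t j.+1 <= T, 0 <= r & r <= T].
  move=> jN /andP[jr rj]; have [h1 h2] := (andP (mesh_itv tM jN)).
  have [h3 h4] := (andP (mesh_itv tM (ltnW jN))).
  by split=> //; [exact: le_trans jr|exact: le_trans h2].
have osc j r s : (j < N)%N -> t j <= r <= t j.+1 -> t j <= s <= t j.+1 ->
    [/\ enorm (dx s - dx r) <= W (t j.+1) - W (t j),
        enorm (da s - da r) <= W (t j.+1) - W (t j),
        enorm (db s - db r) <= W (t j.+1) - W (t j) &
        enorm (u s - u r) <= W (t j.+1) - W (t j)].
  move=> jN.
  wlog rs : r s / r <= s.
    move=> H hr hs; have [rs|/ltW sr] := lerP r s; first exact: H.
    have [? ? ? ?] := H s r sr hs hr.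
    by split; rewrite enormBC.
  move=> hr hs; have [tj0 tjT r0 rT] := jtT j r jN hr.
  have [_ _ s0 sT] := jtT j s jN hs.
  have [h1 h2 h3 h4] := WP r s r0 rs sT.
  have WW : W s - W r <= W (t j.+1) - W (t j).
    move: hr hs => /andP[jr rj] /andP[js sj].
    by rewrite lerB // W_mono.
  by split; apply: le_trans WW.
have w1 j : (j < N)%N -> W (t j.+1) - W (t j) <= w j.
  by move=> jN; rewrite lerDl; case: j jN.
have W0j j : (j < N)%N -> 0 <= W (t j.+1) - W (t j).
  move=> jN; rewrite subr_ge0 W_mono //; last exact: (andP (mesh_itv tM jN)).2.
    exact: (andP (mesh_itv tM (ltnW jN))).1.
  exact/ltW/tS.
have w0 j : (j < N)%N -> 0 <= w j by move=> jN; exact: le_trans (W0j j jN) (w1 j jN).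
have sum_w : \sum_(j < N) w j = Qw.
  rewrite big_split /= -(big_mkord xpredT (fun j => W (t j.+1) - W (t j))).
  rewrite (telescope_sumr (fun j => W (t j))) // t0 tN /Qw; congr (_ + _).
  rewrite -(big_mkord xpredT (fun j => if j is 0%N then C0 else 0)) big_ltn //.
  by rewrite big_nat big1 ?addr0 // => -[].
have wQ j : (j < N)%N -> w j <= Qw.
  move=> jN; rewrite -sum_w (bigD1 (Ordinal jN)) //= lerDl.
  by apply: sumr_ge0 => i _; exact: w0.
have slX j : (j < N)%N -> slope t X j = vel j (X j) by exact: slope_euler tM.
have Xdx j r : (j < N)%N -> t j <= r <= t j.+1 ->
    enorm (slope t X j - dx r) <= w j + L * enorm (X j - x (t j)).
  move=> jN hr; rewrite (slX j jN).
  have tj : t j <= t j <= t j.+1 by rewrite lexx ltW // tS.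
  have [oj _ _ _] := osc j r (t j) jN hr tj.
  apply: le_trans (ler_enorm_distD (dx (t j)) _ _) _.
  rewrite addrC /w -[X in _ <= X]addrA lerD //.
  case: j jN hr tj oj => [|j] jN hr tj oj /=.
    by rewrite t0 subrr enorm0 mulr0 addr0 /C0 lerDl enorm_ge0.
  rewrite add0r (_ : _ - dx (t j.+1) =
    g (X j.+1) (u (t j.+1)) - g (x (t j.+1)) (u (t j.+1))); last first.
    by apply/matrixP => k l; rewrite !mxE; ring.
  have [Uj _] := tA j.+1 jN.
  by have := gL (X j.+1) (x (t j.+1)) _ _ Uj Uj; rewrite subrr enorm0 addr0.
have E_le j : (j <= N)%N -> enorm (e j) <= G * eta.
  apply: (deviation_le T0 (ltW L0) tM xW _ teta w0 _ Xdx) => //.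
  by rewrite sum_w.
have ew j r : (j < N)%N -> t j <= r <= t j.+1 ->
    enorm (slope t X j - dx r) <= w j + L * G * eta.
  move=> jN hr; apply: le_trans (Xdx j r jN hr) _.
  by rewrite lerD2l -mulrA ler_wpM2l ?(ltW L0) //; exact/E_le/ltnW.
have lin j (k l : R) : (j < N)%N -> 0 <= k -> k <= C -> 0 <= l -> l <= C ->
    k * w j + l * eta <= C * (w j + eta).
  by move=> jN k0 kC l0 lC; rewrite (mulrDr C) lerD // ler_wpM2r // w0.
exists X, B, V, (fun j => C * (w j + eta)); split=> //.
- by rewrite /B /e t0 /= subrr mul0mx addr0.
- move=> j jN; rewrite (slX j jN); case: j jN => [|j] jN.
    exists 0; last by rewrite sub0r.
    by apply: normal_cone0; rewrite /B /e t0 /= subrr mul0mx addr0.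
  have [_ [v vN vdx]] := tA j.+1 jN; exists v.
    by have := normal_cone_translate (e j.+1) vN; rewrite /e addrC subrK.
  by rewrite /V /= -vdx; apply/matrixP => k l; rewrite !mxE; ring.
- move=> j r jN hr.
  have tj : t j <= t j <= t j.+1 by rewrite lexx ltW // tS.
  have tj1 : t j <= t j.+1 <= t j.+1 by rewrite lexx ltW // tS.
  have [tj0 tjT r0 rT] := jtT j r jN hr.
  have ha : enorm (slope t (a \o t) j - da r) <= Da * w j.
    apply: (slope_error T0 tM aW jN) => s hs.
    by have [_ h _ _] := osc j r s jN hr hs; exact: le_trans h (w1 j jN).
  have hb : enorm (slope t (b \o t) j - db r) <= Db * w j.
    apply: (slope_error T0 tM bW jN) => s hs.
    by have [_ _ h _] := osc j r s jN hr hs; exact: le_trans h (w1 j jN).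
  have he : enorm (slope t e j) <= n%:R * (w j + L * G * eta).
    rewrite (_ : slope t e j = slope t X j - slope t (x \o t) j); last first.
      rewrite /slope -scalerBr /e /=; congr (_ *: _).
      by apply/matrixP => k l; rewrite !mxE; ring.
    rewrite enormBC -[X in X%:R](mul1n n).
    apply: (slope_error T0 tM xW jN) => s hs.
    by rewrite enormBC ew.
  have hA : enorm (slope t (a \o t) j) <= A1.
    rewrite -[slope _ _ _](subrK (da r)) (le_trans (ler_enormD _ _)) // lerD //.
      by rewrite (le_trans ha) // ler_wpM2l ?wQ.
    rewrite -[da r](subrK (da 0)) addrC (le_trans (ler_enormD _ _)) // lerD2l.
    have [_ h _ _] := WP 0 r (lexx 0) r0 rT; apply: le_trans h _.
    rewrite /Qw -[X in X <= _]addr0 lerD // lerB // W_mono //.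
  split.
  + by rewrite (le_trans (ew j r jN hr)) // -[w j in X in X <= _]mul1r lin.
  + by rewrite (le_trans ha) // -[X in X <= _]addr0 -(mul0r eta) lin.
  + rewrite (slopeD t (b \o t)) slope_mulmx_tr /= addrAC.
    apply: le_trans (ler_enormD _ _) _.
    apply: (@le_trans _ _ (k1 * w j + k2 * eta)); last by rewrite lin.
    rewrite (_ : k1 * w j + k2 * eta = Db * w j + (G * eta * A1 +
      n%:R * (w j + L * G * eta) * Num.sqrt m%:R)); last by rewrite /k1 /k2; ring.
    rewrite lerD // (le_trans (ler_enormD _ _)) // lerD //.
      rewrite (le_trans (enorm_mulmx_tr _ _)) // ler_pM ?enorm_ge0 //.
      exact: E_le.
    rewrite (le_trans (enorm_mulmx_tr _ _)) // ler_pM ?enorm_ge0 //.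
    rewrite enorm_unit_rows // => i; apply: a1.
    by rewrite in_itv /= tj0 (le_trans _ tjT) // ltW // tS.
  + apply: (@le_trans _ _ (w j)); last first.
      by rewrite -[X in X <= _]addr0 -(mul0r eta) -[w j in X in X <= _]mul1r lin.
    case: j jN hr tj tj1 tj0 {tjT ha hb he hA} => [|j] jN hr tj tj1 tj0; last first.
      have [_ _ _ h] := osc j.+1 r (t j.+1) jN hr tj.
      by rewrite (le_trans h) // w1.
    rewrite /= /w (le_trans (ler_enorm_distD (u 0) _ _)) // addrC lerD //.
      have [_ _ _ h] := osc 0%N r (t 0%N) jN hr tj.
      by rewrite -{1}t0.
    by rewrite /C0 lerDr enorm_ge0.
- rewrite -mulr_sumr big_split /= sum_w big_const_ord iter_addr addr0.
  by rewrite -(mulr_natr eta) /eta divfK // pnatr_eq0 -lt0n.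
Qed.

End scheme.

(** * The approximation theorem *)

Theorem theorem4p1 (R : realType) (n m d : nat) (P : problem R n m d)
  (T := horizon P) (U := controls P) (g := perturbation P)
  (xbar : R -> 'rV[R]_n) (abar : R -> 'M[R]_(m, n)) (bbar : R -> 'rV[R]_m)
  (ubar : R -> 'rV[R]_d)
  (dx : R -> 'rV[R]_n) (da : R -> 'M[R]_(m, n)) (db : R -> 'rV[R]_m)
  (U_closed : closed U) (U_bounded : bounded_set U)
  (dab_bounded : exists B : R,
    {ae @lebesgue_measure R, forall t, t \in `[0, T] -> forall i,
      enorm (row i (da t)) <= B /\ `|db t 0 i| <= B})
  (g_lipschitz : exists2 L : R, 0 < L &
    forall x1 x2 u1 u2, U u1 -> U u2 ->
      enorm (g x1 u1 - g x2 u2) <= L * (enorm (x1 - x2) + enorm (u1 - u2)))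
  (g_growth : exists2 M : R, 0 < M &
    forall x u, U u -> enorm (g x u) <= M * (1 + enorm x))
  (a_moduli : exists v dv : 'I_m -> R -> R, forall i,
    W12_scalar T (v i) (dv i) /\
    forall s t, s \in `[0, T] -> t \in `[0, T] ->
      enorm (row i (abar t) - row i (abar s)) <= `|v i t - v i s|)
  (slater : exists theta : R -> R,
    [/\ {within `[0, T], continuous theta},
        sup (theta @` `[0, T]) < 0 &
        forall t, t \in `[0, T] ->
          [set x | forall i, dotp (row i (abar t)) x - bbar t 0 i < theta t]
            !=set0])
  (bar_feasible : feasible P xbar abar bbar ubar dx da db)
  (K : R) (K_gt0 : 0 < K)
  (bar_bv : (maxe (etotal_variation dx 0 T)
              (maxe (etotal_variation da 0 T)
                (maxe (etotal_variation db 0 T)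
                  (etotal_variation ubar 0 T))) <= K%:E)%E) :
  exists (nu : nat -> nat) (nut : R) (t : nat -> nat -> R)
         (x_ : nat -> R -> 'rV[R]_n) (a_ : nat -> R -> 'M[R]_(m, n))
         (b_ : nat -> R -> 'rV[R]_m) (u_ : nat -> R -> 'rV[R]_d)
         (v : nat -> nat -> 'rV[R]_n) (delta : nat -> R),
    [/\ 0 < nut,
        (forall k, [/\ (k <= nu k)%N, mesh_points T (nu k) (t k) &
           forall j, (j < nu k)%N -> t k j.+1 - t k j <= nut / (nu k)%:R]),
        (forall k, [/\ piecewise_linear (nu k) (t k) (x_ k),
                       piecewise_linear (nu k) (t k) (a_ k),
                       piecewise_linear (nu k) (t k) (b_ k) &
                       piecewise_constant (nu k) (t k) (u_ k)]),
        (forall k, 0 < delta k) /\ delta k @[k --> \oo] --> 0 &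
    [/\ (forall k, [/\ x_ k 0 = start_x P, a_ k 0 = start_a P &
                       b_ k 0 = start_b P]),
        (forall k j i, (j <= nu k)%N ->
           1 - delta k <= enorm (row i (a_ k (t k j))) <= 1 + delta k),
        (forall k j, (j < nu k)%N ->
           (forall s, t k j <= s <= t k j.+1 ->
              x_ k s = x_ k (t k j) + (s - t k j) *: v k j) /\
           sweep_map g (x_ k (t k j)) (a_ k (t k j)) (b_ k (t k j))
             (u_ k (t k j)) (- v k j)),
        [/\ W12_cvg T x_ xbar, W12_cvg T a_ abar & W12_cvg T b_ bbar] &
        L2_cvg T u_ ubar]].
Proof.
have T0 : 0 < T := horizon_gt0 P.
have [L L0 gL] := g_lipschitz.
have [xW aW bW uL2 incl x0 a0 b0 C0 uU a1 _ _] := bar_feasible.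
move: bar_bv; rewrite !ge_max => /andP[xK /andP[aK /andP[bK uK]]].
have [Wx WxP] := bv_modulus xK; have [Wa WaP] := bv_modulus aK.
have [Wb WbP] := bv_modulus bK; have [Wu WuP] := bv_modulus uK.
(* A single function controls the oscillation of all four curves. *)
pose W s := Wx s + Wa s + Wb s + Wu s.
have WP r s : 0 <= r -> r <= s -> s <= T ->
    [/\ enorm (dx s - dx r) <= W s - W r, enorm (da s - da r) <= W s - W r,
        enorm (db s - db r) <= W s - W r & enorm (ubar s - ubar r) <= W s - W r].
  move=> r0 rs sT; rewrite /W.
  have := (WxP r s r0 rs sT, WaP r s r0 rs sT, WbP r s r0 rs sT, WuP r s r0 rs sT).
  have := (enorm_ge0 (dx s - dx r), enorm_ge0 (da s - da r),
           enorm_ge0 (db s - db r), enorm_ge0 (ubar s - ubar r)).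
  move=> [[[p1 p2] p3] p4] [[[q1 q2] q3] q4].
  by clear -p1 p2 p3 p4 q1 q2 q3 q4; split; lra.
(* The points which may serve as inner nodes. *)
pose A s := s \in `[0, T] -> U (ubar s) /\
  [set - v + g (xbar s) (ubar s) |
     v in normal_cone (xbar s) (polyhedron (abar s) (bbar s))] (dx s).
have aeA : {ae @lebesgue_measure R, forall s, A s}.
  apply: negligibleS (negligibleU uU incl); rewrite -setCI; apply: subsetC.
  by move=> s [us is_] sT; split; [exact: us|exact: is_].
have [u0 Uu0] : exists u0, U u0.
  have [s /andP[s0 sT] As] := ae_itv_exists T0 aeA.
  by exists (ubar s); apply: (As _).1; rewrite in_itv /= !ltW.
have x0C : polyhedron (abar 0) (bbar 0) (xbar 0) by rewrite x0.
have a1' s i : s \in `[0, T] -> enorm (row i (abar s)) = 1 by exact: a1.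
have [Q scheme] := tracking_scheme u0 T0 xW aW bW WP L0 gL x0C a1'.
have [t tP] := choice (fun k => mesh_in_ae T0 (ltn0Sn k) aeA).
have tM k : mesh_points T k.+1 (t k) by have [] := tP k.
have teta k j : (j < k.+1)%N -> t k j.+1 - t k j <= 2 * T / k.+1%:R.
  by have [_ _] := tP k; apply.
have tA k j : (0 < j < k.+1)%N -> U (ubar (t k j)) /\
    [set - v + g (xbar (t k j)) (ubar (t k j)) |
       v in normal_cone (xbar (t k j)) (polyhedron (abar (t k j)) (bbar (t k j)))]
      (dx (t k j)).
  move=> jk; have [_ At _] := tP k; have /andP[_ /ltnW jk'] := jk.
  by apply: At jk _; rewrite in_itv /= (mesh_itv (tM k) jk').
have [X XP] := choice (fun k => scheme k.+1 (t k) (ltn0Sn k) (tM k) (teta k) (tA k)).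
have [B BP] := choice XP.
have [V VP] := choice BP.
have [c cP] := choice VP.
pose eta k : R := 2 * T / k.+1%:R.
have eta0 : eta k @[k --> \oo] --> 0.
  rewrite -(mulr0 (2 * T)); apply: cvgM; first exact: cvg_cst.
  exact: cvg_harmonic.
have etaM k : eta k <= 2 * T.
  by rewrite ler_pdivrMr ?ltr0n // ler_peMr ?ler1n // mulr_ge0 // ltW.
have cQ k : \sum_(j < k.+1) c k j <= Q by have [] := cP k.
(* The sampled normals have norm 1, so that any positive null sequence serves
   as delta. *)
exists S, (2 * T), t, (fun k => polygon (t k) k.+1 (X k)),
  (fun k => polygon (t k) k.+1 (abar \o t k)),
  (fun k => polygon (t k) k.+1 (B k)),
  (fun k => step_function (t k) k.+1 (V k)),
  (fun k => slope (t k) (X k)), (fun k => k.+1%:R^-1).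
split; [| | | |split].
- by rewrite mulr_gt0.
- by move=> k; split; [exact: leqnSn|exact: tM|exact: teta].
- move=> k; split; by [exact: polygon_piecewise_linear (tM k)|
    exact: step_function_piecewise_constant (tM k)].
- by split=> [k|]; [rewrite invr_gt0 ltr0n|exact: cvg_harmonic].
- move=> k; have [X0 B0 _ _ _] := cP k; have [t0 _ _] := tM k.
  by rewrite !(polygon0 _ (tM k)) X0 B0 /= t0 x0 a0 b0.
- move=> k j i jk; rewrite (polygon_node _ (tM k) jk) /= a1'.
    by rewrite lerBlDr lerDl andbb invr_ge0 ler0n.
  by rewrite in_itv /= (mesh_itv (tM k)).
- move=> k j jk; have [_ _ cone _ _] := cP k.
  rewrite !(polygon_node _ (tM k) (ltnW jk)); split.
    by move=> s js; exact: polygonE (tM k) jk js.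
  rewrite (step_functionE _ (tM k) jk); first exact: cone.
  by rewrite lexx; have [_ _] := tM k; apply.
- split.
  + apply: (W12_cvg_polygon T0 _ tM xW _ _ teta cQ etaM eta0) => // k.
      by have [] := cP k.
    by move=> j r jk jr; have [_ _ _ /(_ j r jk jr)[]] := cP k.
  + apply: (W12_cvg_polygon T0 _ tM aW _ _ teta cQ etaM eta0) => // k.
      by rewrite /= ; have [-> _ _] := tM k.
    by move=> j r jk jr; have [_ _ _ /(_ j r jk jr)[]] := cP k.
  + apply: (W12_cvg_polygon T0 _ tM bW _ _ teta cQ etaM eta0) => // k.
      by have [] := cP k.
    by move=> j r jk jr; have [_ _ _ /(_ j r jk jr)[]] := cP k.
- apply: (L2_cvg_step_function T0 _ tM uL2 _ teta cQ eta0) => // k j r jk jr.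
  by have [_ _ _ /(_ j r jk jr)[]] := cP k.
Qed.
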